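(* (a) The index set $UHL=\{e:\mathcal{A}_e\text{ is an ultrahomogeneous linear ordering}\}$ is $\Pi^0_2$ complete, and in fact $\Pi^0_2$ complete relative to $LIN$. (b) The index set $WUL=\{e:\mathcal{A}_e\text{ is a weakly ultrahomogeneous linear ordering}\}$ is $\Sigma^0_3$ complete, and in fact $\Sigma^0_3$ complete relative to $LIN$.
   Context: $\{\varphi_e\}_{e\in\omega}$ is the standard enumeration of the partial computable functions. $\mathcal{A}_e=(\omega,<_e)$ is the computable linear order whose relation $<_e$ has characteristic function $\varphi_e$ (via a standard coding of pairs), defined when $\varphi_e$ is total and is the characteristic function of a linear ordering of $\omega$; $LIN=\{e:\mathcal{A}_e\text{ is a linear ordering}\}$. A linear ordering is ultrahomogeneous if every isomorphism between finite suborders extends to an automorphism; it is weakly ultrahomogeneous if there is a finite set $\{a_1,\dots,a_n\}$ of elements such that every isomorphism between finite suborders containing all $a_i$ and fixing each $a_i$ extends to an automorphism. For a class $\Gamma$ (such as $\Pi^0_2$ or $\Sigma^0_3$), a set $B\subseteq\omega$ is $\Gamma$ complete if $B\in\Gamma$ and for every $A\in\Gamma$ there is a computable $f$ with $i\in A\iff f(i)\in B$ for all $i$. For $B\subseteq C\subseteq\omega$, $B$ is $\Gamma$ complete relative to $C$ if $B=C\cap R$ for some $R\in\Gamma$ and for every $A\in\Gamma$ there is a computable $f$ with $f(i)\in C$ for all $i$ and $i\in A\iff f(i)\in B$ for all $i$. *)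

(* Defs.v *)
From Stdlib Require Import Arith Lia List RelationClasses Cantor.

(** A partial function on the natural numbers, given by its graph. *)
Definition pfun := nat -> nat -> Prop.

Notation "⟨ x , y ⟩" := (Cantor.to_nat (x, y)) (at level 0, x at level 99, y at level 99).

(** Programs for unary partial recursive functions; functions of several
    arguments are handled through the Cantor pairing bijection, so that the
    identity is [Pair Fst Snd] and the other projections are composites. *)
Inductive code : Set :=
| Zero
| Succ
| Fst
| Snd
| Pair (c d : code)
| Comp (c d : code)
| Prec (c d : code)
| Mu (c : code).

Definition pair_graph (f g : pfun) : pfun :=
  fun x z => exists a b, f x a /\ g x b /\ z = ⟨a, b⟩.

Definition comp_graph (f g : pfun) : pfun :=
  fun x z => exists y, g x y /\ f y z.

(** [h(a, 0) = f(a)] and [h(a, n+1) = g(a, (n, h(a, n)))]. *)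
Fixpoint prec_graph (f g : pfun) (a n : nat) (z : nat) : Prop :=
  match n with
  | 0 => f a z
  | S m => exists y, prec_graph f g a m y /\ g ⟨a, ⟨m, y⟩⟩ z
  end.

(** The least [n] with [f(x, n) = 0], where [f(x, m)] must be defined and
    nonzero for every [m < n]. *)
Definition mu_graph (f : pfun) : pfun :=
  fun x n => f ⟨x, n⟩ 0 /\ forall m, m < n -> exists k, f ⟨x, m⟩ (S k).

Fixpoint eval (c : code) : pfun :=
  match c with
  | Zero => fun _ y => y = 0
  | Succ => fun x y => y = S x
  | Fst => fun x y => y = fst (Cantor.of_nat x)
  | Snd => fun x y => y = snd (Cantor.of_nat x)
  | Pair c d => pair_graph (eval c) (eval d)
  | Comp c d => comp_graph (eval c) (eval d)
  | Prec c d => fun x =>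
      prec_graph (eval c) (eval d) (fst (Cantor.of_nat x)) (snd (Cantor.of_nat x))
  | Mu c => mu_graph (eval c)
  end.

(** A bijective Gödel numbering of programs; see [encode_inj] and
    [encode_surj]. *)
Fixpoint encode (c : code) : nat :=
  match c with
  | Zero => 0
  | Succ => 1
  | Fst => 2
  | Snd => 3
  | Pair c d => 4 + 4 * ⟨encode c, encode d⟩
  | Comp c d => 5 + 4 * ⟨encode c, encode d⟩
  | Prec c d => 6 + 4 * ⟨encode c, encode d⟩
  | Mu c => 7 + 4 * encode c
  end.

Lemma encode_inj c d : encode c = encode d -> c = d.
Proof.
revert d; induction c; destruct d; cbn [encode]; intros H;
  try reflexivity; try (exfalso; lia).
1-3: assert (E : ⟨encode c1, encode c2⟩ = ⟨encode d1, encode d2⟩) by lia;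
  apply (f_equal Cantor.of_nat) in E; rewrite !Cantor.cancel_of_to in E;
  injection E as E1 E2; f_equal; auto.
f_equal; apply IHc; lia.
Qed.

Lemma encode_surj e : exists c, encode c = e.
Proof.
induction e as [e IH] using (well_founded_induction lt_wf).
destruct (le_lt_dec 4 e) as [H | H].
2: { destruct e as [| [| [| [| e]]]]; [exists Zero | exists Succ | exists Fst
     | exists Snd | lia]; reflexivity. }
pose proof (Nat.div_mod_eq (e - 4) 4) as D.
pose proof (Nat.mod_upper_bound (e - 4) 4 ltac:(lia)) as M.
set (q := (e - 4) / 4) in *; set (r := (e - 4) mod 4) in *.
pose proof (Cantor.cancel_to_of q) as Q.
destruct (Cantor.of_nat q) as [x y].
pose proof (Cantor.to_nat_non_decreasing x y) as L.
destruct (IH x ltac:(lia)) as [c Hc], (IH y ltac:(lia)) as [d Hd].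
destruct (IH q ltac:(lia)) as [b Hb].
destruct r as [| [| [| [| r]]]];
  [exists (Pair c d) | exists (Comp c d) | exists (Prec c d) | exists (Mu b) | lia];
  cbn [encode]; rewrite ?Hc, ?Hd, ?Hb, ?Q; lia.
Qed.

Lemma eval_fun c x y z : eval c x y -> eval c x z -> y = z.
Proof.
revert x y z; induction c; cbn [eval]; intros x y z.
1-4: intros; congruence.
- intros (a & b & Ha & Hb & ->) (a' & b' & Ha' & Hb' & ->).
  now rewrite (IHc1 _ _ _ Ha Ha'), (IHc2 _ _ _ Hb Hb').
- intros (a & Ha & Hy) (b & Hb & Hz).
  rewrite (IHc2 _ _ _ Ha Hb) in Hy; eauto.
- generalize (fst (Cantor.of_nat x)) as a; intros a.
  generalize (snd (Cantor.of_nat x)) as n; intros n.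
  revert y z; induction n as [| n IH]; cbn [prec_graph]; intros y z.
  + apply IHc1.
  + intros (u & Hu & Hy) (v & Hv & Hz).
    rewrite (IH _ _ Hu Hv) in Hy; eauto.
- intros [Hy Ly] [Hz Lz].
  destruct (lt_eq_lt_dec y z) as [[H | H] | H]; auto; exfalso.
  + destruct (Lz _ H) as [k Hk]; discriminate (IHc _ _ _ Hy Hk).
  + destruct (Ly _ H) as [k Hk]; discriminate (IHc _ _ _ Hz Hk).
Qed.

(** [phi e x y] means that the [e]-th partial computable function is defined
    at [x] with value [y]. *)
Definition phi (e : nat) : pfun := fun x y => exists c, encode c = e /\ eval c x y.

Definition computable_fun (f : nat -> nat) : Prop :=
  exists e, forall x, phi e x (f x).

Definition computable_set (A : nat -> Prop) : Prop :=
  exists e, forall x, (A x -> phi e x 1) /\ (~ A x -> phi e x 0).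

Fixpoint Sigma0 (n : nat) (A : nat -> Prop) {struct n} : Prop :=
  match n with
  | 0 => computable_set A
  | S m => exists B, Pi0 m B /\ forall x, A x <-> exists y, B ⟨x, y⟩
  end
with Pi0 (n : nat) (A : nat -> Prop) {struct n} : Prop :=
  match n with
  | 0 => computable_set A
  | S m => exists B, Sigma0 m B /\ forall x, A x <-> forall y, B ⟨x, y⟩
  end.

Definition complete (Gamma : (nat -> Prop) -> Prop) (B : nat -> Prop) : Prop :=
  Gamma B /\
  forall A, Gamma A ->
    exists f, computable_fun f /\ forall i, A i <-> B (f i).

Definition complete_relative (Gamma : (nat -> Prop) -> Prop) (B C : nat -> Prop) : Prop :=
  (exists R, Gamma R /\ forall i, B i <-> C i /\ R i) /\
  forall A, Gamma A ->
    exists f, computable_fun f /\ (forall i, C (f i)) /\ forall i, A i <-> B (f i).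

Definition linear_order {T : Type} (R : T -> T -> Prop) : Prop :=
  StrictOrder R /\ forall x y, R x y \/ x = y \/ R y x.

(** [f] restricts to an isomorphism from the suborder on [X] onto the suborder
    on [Y]; its values outside [X] are irrelevant. *)
Definition order_iso {T : Type} (R : T -> T -> Prop) (X Y : T -> Prop) (f : T -> T) : Prop :=
  (forall x, X x -> Y (f x)) /\
  (forall y, Y y -> exists x, X x /\ f x = y) /\
  (forall x x', X x -> X x' -> f x = f x' -> x = x') /\
  (forall x x', X x -> X x' -> (R x x' <-> R (f x) (f x'))).

Definition automorphism {T : Type} (R : T -> T -> Prop) (g : T -> T) : Prop :=
  order_iso R (fun _ => True) (fun _ => True) g.

(** Lists represent finite sets, through the predicate [In]. *)
Definition ultrahomogeneous {T : Type} (R : T -> T -> Prop) : Prop :=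
  forall (F G : list T) (f : T -> T),
    order_iso R (fun x => In x F) (fun y => In y G) f ->
    exists g, automorphism R g /\ forall x, In x F -> g x = f x.

Definition weakly_ultrahomogeneous {T : Type} (R : T -> T -> Prop) : Prop :=
  exists a : list T,
  forall (F G : list T) (f : T -> T),
    incl a F -> incl a G ->
    order_iso R (fun x => In x F) (fun y => In y G) f ->
    (forall x, In x a -> f x = x) ->
    exists g, automorphism R g /\ forall x, In x F -> g x = f x.

Definition ord (e x y : nat) : Prop := phi e ⟨x, y⟩ 1.

(** The first clause says that [phi e] is total and is the characteristic
    function of the relation [ord e]. *)
Definition LIN (e : nat) : Prop :=
  (forall n, phi e n 0 \/ phi e n 1) /\ linear_order (ord e).

Definition UHL (e : nat) : Prop := LIN e /\ ultrahomogeneous (ord e).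

Definition WUL (e : nat) : Prop := LIN e /\ weakly_ultrahomogeneous (ord e).

(* Main.v *)
Require Import Defs.
From Stdlib Require Import Arith Lia List Cantor Classical ClassicalEpsilon.
Import ListNotations.

(** The link between homogeneity and the arithmetical hierarchy is density.
    Call a linear order [R] on the natural numbers dense off [n] ([dense_off])
    if every pair [x], [y] with [R x y] and no [c < n] in the closed interval
    from [x] to [y] admits points below [x], between [x] and [y], and above
    [y], all in an interval that still avoids every [c < n].  A back-and-forth
    argument ([homogeneous_dense_off], [dense_off_homogeneous]) shows that this
    is equivalent to homogeneity over the finite set of all [c < n].  Since
    homogeneity over a finite set passes to every larger finite set, [R] is
    weakly ultrahomogeneous if and only if it is dense off some [n], and it is
    ultrahomogeneous if and only if it is dense off [0].

    Upper bounds.  Convergence of a program is recursively enumerable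
    ([re_phi]): it is witnessed by a finite list of computed values, each
    justified by others in the list.  Once [phi e] is required to be total, being
    a linear order and being dense off [n] are both of the form: for all [t], a
    recursively enumerable condition ([dense_LIN_clauses]).  So [UHL] is Pi2,
    and the extra existential quantifier over [n] makes [WUL] Sigma3.

    Hardness.  A Pi2 set has the form: infinitely many [v] satisfy [Q i v],
    with [Q] decidable ([Pi2_infinitely_often]).  Build a linear order by
    inserting the numbers one after the other, each one immediately above an
    earlier number, its parent; the point [0] is a virtual least element,
    deleted in the end.  A point that is the parent of infinitely many others
    is fertile, and points get inserted above it closer than any given
    one; a point with finitely many children either is the greatest
    or has an immediate successor.  The point [0] is always fertile, so the
    order left after its deletion has no least element.

    For (a), let every point receive a child at each [v] with [Q i v].  If [i]
    belongs to the set, every point is fertile and the order is dense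
    without endpoints; if not, every point other than [0] has finitely many
    children.

    For (b), the set is a union over [w] of Pi2 sets, and a point [x] receives
    a child at each witness for some [w <= x].  If some [w] works, all
    points that are larger than [w] as numbers are fertile; a finite set of exceptional points, enlarged by their
    immediate successors, then serves as the parameters ([fertile_dense]).  If
    no [w] works, every point other than [0] has finitely many children, so
    arbitrarily far down there are adjacent points, and no finite set of
    parameters can separate them all ([sterile_not_dense]).

    In both cases the order is computable uniformly in [i]
    ([dec_insertion]), and it is a linear order whatever [i] is, which gives
    completeness relative to [LIN]. *)

(** * Pairs *)

Definition p1 (n : nat) : nat := fst (Cantor.of_nat n).
Definition p2 (n : nat) : nat := snd (Cantor.of_nat n).

Lemma p1_pair x y : p1 ⟨x, y⟩ = x.
Proof. unfold p1; now rewrite Cantor.cancel_of_to. Qed.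

Lemma p2_pair x y : p2 ⟨x, y⟩ = y.
Proof. unfold p2; now rewrite Cantor.cancel_of_to. Qed.

Lemma pair_surj n : ⟨p1 n, p2 n⟩ = n.
Proof. unfold p1, p2; rewrite <- surjective_pairing; apply Cantor.cancel_to_of. Qed.

Lemma pair_ge x y : x <= ⟨x, y⟩ /\ y <= ⟨x, y⟩.
Proof. pose proof (Cantor.to_nat_non_decreasing x y); lia. Qed.

Ltac unpair := repeat (rewrite ?p1_pair, ?p2_pair in * ).

(** * Total computable functions *)

Definition computable (f : nat -> nat) : Prop := exists c, forall x, eval c x (f x).

Lemma computable_ext f g : (forall x, f x = g x) -> computable f -> computable g.
Proof. intros E [c Hc]; exists c; intros x; rewrite <- E; apply Hc. Qed.

Lemma computable_id : computable (fun x => x).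
Proof.
exists (Pair Fst Snd); intros x; cbn.
exists (p1 x), (p2 x); repeat split; symmetry; apply pair_surj.
Qed.

Lemma computable_comp f g : computable f -> computable g -> computable (fun x => f (g x)).
Proof. intros [c Hc] [d Hd]; exists (Comp c d); intros x; exists (g x); auto. Qed.

Lemma computable_pair f g :
  computable f -> computable g -> computable (fun x => ⟨f x, g x⟩).
Proof.
intros [c Hc] [d Hd]; exists (Pair c d); intros x.
exists (f x), (g x); auto.
Qed.

Lemma computable_S f : computable f -> computable (fun x => S (f x)).
Proof. intros Hf; apply (computable_comp S); [exists Succ; reflexivity | exact Hf]. Qed.

Lemma computable_p1 f : computable f -> computable (fun x => p1 (f x)).
Proof. intros Hf; apply (computable_comp p1); [exists Fst; reflexivity | exact Hf]. Qed.

Lemma computable_p2 f : computable f -> computable (fun x => p2 (f x)).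
Proof. intros Hf; apply (computable_comp p2); [exists Snd; reflexivity | exact Hf]. Qed.

Fixpoint const_code (k : nat) : code :=
  match k with 0 => Zero | S j => Comp Succ (const_code j) end.

Lemma eval_const_code k x : eval (const_code k) x k.
Proof. induction k as [| k IH]; cbn; [reflexivity | exists k; auto]. Qed.

Lemma computable_const k : computable (fun _ => k).
Proof. exists (const_code k); intros x; apply eval_const_code. Qed.

(** Primitive recursion in a context [x]; the step reads [x], the index and
    the previous value off a coded triple. *)
Lemma computable_rec b h n :
  computable b -> computable (fun u => h (p1 u) (p1 (p2 u)) (p2 (p2 u))) -> computable n ->
  computable (fun x => nat_rec (fun _ => nat) (b x) (h x) (n x)).
Proof.
intros Hb [d Hd] Hn.
apply (computable_ext
  (fun x => (fun u => nat_rec (fun _ => nat) (b (p1 u)) (h (p1 u)) (p2 u)) ⟨x, n x⟩)).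
{ intros x; cbn beta; now unpair. }
refine (computable_comp
  (fun u => nat_rec (fun _ => nat) (b (p1 u)) (h (p1 u)) (p2 u)) (fun x => ⟨x, n x⟩) _ _).
2: { apply computable_pair; [apply computable_id | exact Hn]. }
destruct Hb as [c Hc].
exists (Prec c d); intros u; cbn [eval].
fold (p1 u) (p2 u); generalize (p1 u) as a, (p2 u) as m; intros a m.
induction m as [| m IH]; cbn [nat_rec nat_rect prec_graph]; [apply Hc |].
eexists; split; [exact IH |].
specialize (Hd ⟨a, ⟨m, nat_rec (fun _ => nat) (b a) (h a) m⟩⟩).
cbn beta in Hd; unpair; exact Hd.
Qed.

(** Proves computability by following the syntax of the body; goals beyond its
    reach are left to the user. *)
Ltac computability :=
  cbn beta;
  match goal with
  | H : computable ?f |- computable ?f => exact H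
  | |- computable (fun _ => ?k) => exact (computable_const k)
  | |- computable (fun x => x) => exact computable_id
  | |- computable p1 => exact (computable_p1 _ computable_id)
  | |- computable p2 => exact (computable_p2 _ computable_id)
  | |- computable (fun x => p1 (@?f x)) => apply (computable_p1 f); computability
  | |- computable (fun x => p2 (@?f x)) => apply (computable_p2 f); computability
  | |- computable (fun x => S (@?f x)) => apply (computable_S f); computability
  | |- computable (fun x => Cantor.to_nat (@?f x, @?g x)) =>
      apply (computable_pair f g); computability
  | H : computable ?f |- computable (fun x => ?f (@?g x)) =>
      apply (computable_comp f g H); computability
  | _ => solve [eauto with computability]
  | _ => idtac
  end.

Create HintDb computability.

Lemma computable_add f g : computable f -> computable g -> computable (fun x => f x + g x).
Proof.
intros Hf Hg.
apply (computable_ext (fun x => nat_rec (fun _ => nat) (g x) (fun _ y => S y) (f x))).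
- intros x; induction (f x); cbn; congruence.
- apply (computable_rec g (fun _ _ y => S y)); computability.
Qed.

Lemma computable_mul f g : computable f -> computable g -> computable (fun x => f x * g x).
Proof.
intros Hf Hg.
apply (computable_ext (fun x => nat_rec (fun _ => nat) 0 (fun _ y => g x + y) (f x))).
- intros x; induction (f x); cbn; congruence.
- apply (computable_rec (fun _ => 0) (fun x _ y => g x + y)); computability.
  apply computable_add; computability.
Qed.

Lemma computable_sub f g : computable f -> computable g -> computable (fun x => f x - g x).
Proof.
intros Hf Hg.
apply (computable_ext (fun x => nat_rec (fun _ => nat) (f x) (fun _ y => pred y) (g x))).
- intros x; induction (g x); cbn; lia.
- apply (computable_rec f (fun _ _ y => pred y)); computability.
  (* The predecessor is a recursion that forgets the previous value. *)
  apply (computable_ext (fun u => nat_rec (fun _ => nat) 0 (fun m _ => m) (p2 (p2 u)))).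
  { intros u; destruct (p2 (p2 u)); reflexivity. }
  apply (computable_rec (fun _ => 0) (fun _ m _ => m)); computability.
Qed.

#[export] Hint Extern 2 (computable (fun x => @?f x + @?g x)) =>
  apply (computable_add f g); computability : computability.
#[export] Hint Extern 2 (computable (fun x => @?f x * @?g x)) =>
  apply (computable_mul f g); computability : computability.
#[export] Hint Extern 2 (computable (fun x => @?f x - @?g x)) =>
  apply (computable_sub f g); computability : computability.


(** * Decidable sets *)

(** Sets are predicates, not boolean functions, so that their closure
    properties follow the logical connectives; the characteristic function
    then exists only classically. *)
Definition char (A : nat -> Prop) (x : nat) : nat :=
  if excluded_middle_informative (A x) then 1 else 0.

Definition dec (A : nat -> Prop) : Prop := computable (char A).

Lemma char_spec A x : (A x -> char A x = 1) /\ (~ A x -> char A x = 0).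
Proof. unfold char; destruct (excluded_middle_informative (A x)); tauto. Qed.

Lemma dec_intro A f :
  (forall x, (A x -> f x = 1) /\ (~ A x -> f x = 0)) -> computable f -> dec A.
Proof.
intros H; apply computable_ext; intros x.
destruct (char_spec A x), (H x), (classic (A x)); intuition congruence.
Qed.

Lemma dec_computable_set A : dec A <-> computable_set A.
Proof.
split.
- intros [c Hc]; exists (encode c); intros x; specialize (Hc x).
  destruct (char_spec A x) as [H1 H0].
  split; intros h; exists c; split; auto.
  + now rewrite <- (H1 h).
  + now rewrite <- (H0 h).
- intros [e He]; destruct (encode_surj e) as [c <-].
  exists c; intros x; destruct (char_spec A x) as [H1 H0].
  destruct (classic (A x)) as [h | h].
  + rewrite (H1 h); destruct (proj1 (He x) h) as [d [E H]].
    now rewrite <- (encode_inj _ _ E).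
  + rewrite (H0 h); destruct (proj2 (He x) h) as [d [E H]].
    now rewrite <- (encode_inj _ _ E).
Qed.

Lemma dec_ext A B : (forall x, A x <-> B x) -> dec A -> dec B.
Proof.
intros E; apply dec_intro; intros x; rewrite <- E; apply char_spec.
Qed.

Lemma dec_subst A f : dec A -> computable f -> dec (fun x => A (f x)).
Proof. intros HA Hf; exact (computable_comp (char A) f HA Hf). Qed.

Lemma dec_le f g : computable f -> computable g -> dec (fun x => f x <= g x).
Proof.
intros Hf Hg; apply (dec_intro _ (fun x => 1 - (f x - g x))); [lia | computability].
Qed.

Lemma dec_and A B : dec A -> dec B -> dec (fun x => A x /\ B x).
Proof.
unfold dec; intros HA HB; apply (dec_intro _ (fun x => char A x * char B x)); [| computability].
intros x; unfold char.
destruct (excluded_middle_informative (A x)), (excluded_middle_informative (B x)); tauto.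
Qed.

Lemma dec_not A : dec A -> dec (fun x => ~ A x).
Proof.
unfold dec; intros HA; apply (dec_intro _ (fun x => 1 - char A x)); [| computability].
intros x; unfold char; destruct (excluded_middle_informative (A x)); tauto.
Qed.

Lemma dec_or A B : dec A -> dec B -> dec (fun x => A x \/ B x).
Proof.
intros HA HB; apply (dec_ext (fun x => ~ (~ A x /\ ~ B x))); [intros x; tauto |].
apply dec_not, dec_and; now apply dec_not.
Qed.

Lemma dec_lt f g : computable f -> computable g -> dec (fun x => f x < g x).
Proof. intros Hf Hg; apply (dec_le (fun x => S (f x))); computability. Qed.

Lemma dec_eq f g : computable f -> computable g -> dec (fun x => f x = g x).
Proof.
intros Hf Hg; apply (dec_ext (fun x => f x <= g x /\ g x <= f x)); [lia |].
apply dec_and; now apply dec_le.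
Qed.

(** Here and below, a binary predicate enters the hypotheses through the pair
    coding, and the conclusion is about [x] alone. *)
Lemma dec_all_lt n P :
  computable n -> dec (fun u => P (p1 u) (p2 u)) ->
  dec (fun x => forall i, i < n x -> P x i).
Proof.
unfold dec; intros Hn HP.
apply (dec_intro _ (fun x => nat_rec (fun _ => nat) 1
  (fun i y => char (fun u => P (p1 u) (p2 u)) ⟨x, i⟩ * y) (n x))).
- intros x; generalize (n x) as m; intros m.
  induction m as [| m [IH1 IH0]]; cbn [nat_rec nat_rect]; [split; [auto | intros []; lia] |].
  destruct (char_spec (fun u => P (p1 u) (p2 u)) ⟨x, m⟩) as [H1 H0].
  cbn beta in H1, H0; unpair; split; intros H.
  + rewrite H1, IH1; auto.
  + destruct (classic (P x m)) as [h | h]; [| rewrite H0; auto].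
    rewrite IH0; [lia |]; intros H'; apply H; intros i Hi.
    destruct (Nat.eq_dec i m) as [-> | ?]; [auto | apply H'; lia].
- apply (computable_rec (fun _ => 1)
    (fun x i y => char (fun u => P (p1 u) (p2 u)) ⟨x, i⟩ * y)); computability.
Qed.

Lemma dec_ex_lt n P :
  computable n -> dec (fun u => P (p1 u) (p2 u)) ->
  dec (fun x => exists i, i < n x /\ P x i).
Proof.
intros Hn HP; apply (dec_ext (fun x => ~ forall i, i < n x -> ~ P x i)).
- intros x; split.
  + intros H; apply NNPP; intros H'; apply H; intros i Hi h; apply H'; eauto.
  + intros (i & Hi & h) H; exact (H i Hi h).
- apply dec_not, (dec_all_lt n (fun x i => ~ P x i)); [exact Hn |].
  now apply dec_not.
Qed.

Lemma computable_if A f g :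
  dec A -> computable f -> computable g ->
  computable (fun x => if excluded_middle_informative (A x) then f x else g x).
Proof.
unfold dec; intros HA Hf Hg.
apply (computable_ext (fun x => char A x * f x + (1 - char A x) * g x)); [| computability].
intros x; unfold char; destruct (excluded_middle_informative (A x)); lia.
Qed.

(** * Recursively enumerable sets *)

Definition re (A : nat -> Prop) : Prop :=
  exists C, dec C /\ forall x, A x <-> exists y, C ⟨x, y⟩.

Lemma re_ext A B : (forall x, A x <-> B x) -> re A -> re B.
Proof.
intros E (C & HC & H); exists C; split; [exact HC |].
intros x; rewrite <- E; apply H.
Qed.

Lemma re_dec A : dec A -> re A.
Proof.
intros HA; exists (fun u => A (p1 u)); split.
- apply (dec_subst A p1 HA); computability.
- intros x; split; [intros h; exists 0 | intros [y h]]; now rewrite p1_pair in *.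
Qed.

Lemma re_subst A f : re A -> computable f -> re (fun x => A (f x)).
Proof.
intros (C & HC & H) Hf; exists (fun u => C ⟨f (p1 u), p2 u⟩); split.
- apply (dec_subst C (fun u => ⟨f (p1 u), p2 u⟩) HC); computability.
- intros x; rewrite H; split; intros [y Hy]; exists y; now unpair.
Qed.

Lemma re_ex P : re (fun u => P (p1 u) (p2 u)) -> re (fun x => exists y, P x y).
Proof.
intros (C & HC & H); exists (fun u => C ⟨⟨p1 u, p1 (p2 u)⟩, p2 (p2 u)⟩); split.
- apply (dec_subst C (fun u => ⟨⟨p1 u, p1 (p2 u)⟩, p2 (p2 u)⟩) HC); computability.
- intros x; split.
  + intros [y Hy].
    destruct (H ⟨x, y⟩) as [[z Hz] _]; [now unpair |].
    exists ⟨y, z⟩; now unpair.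
  + intros [t Ht]; unpair; exists (p1 t).
    destruct (H ⟨x, p1 t⟩) as [_ H']; unpair; eauto.
Qed.

Lemma re_and A B : re A -> re B -> re (fun x => A x /\ B x).
Proof.
intros (C & HC & H) (D & HD & H').
exists (fun u => C ⟨p1 u, p1 (p2 u)⟩ /\ D ⟨p1 u, p2 (p2 u)⟩); split.
- apply dec_and.
  + apply (dec_subst C (fun u => ⟨p1 u, p1 (p2 u)⟩) HC); computability.
  + apply (dec_subst D (fun u => ⟨p1 u, p2 (p2 u)⟩) HD); computability.
- intros x; rewrite H, H'; split.
  + intros [[y Hy] [z Hz]]; exists ⟨y, z⟩; now unpair.
  + intros [t Ht]; unpair; split; eexists; apply Ht.
Qed.

Lemma re_or A B : re A -> re B -> re (fun x => A x \/ B x).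
Proof.
intros (C & HC & H) (D & HD & H').
exists (fun u => C u \/ D u); split; [now apply dec_or |].
intros x; rewrite H, H'; firstorder.
Qed.

(** A common bound for the finitely many witnesses makes them searchable. *)
Lemma re_all_lt n P :
  computable n -> re (fun u => P (p1 u) (p2 u)) ->
  re (fun x => forall i, i < n x -> P x i).
Proof.
intros Hn (C & HC & H).
exists (fun u => forall i, i < n (p1 u) -> exists y, y < p2 u /\ C ⟨⟨p1 u, i⟩, y⟩); split.
- apply (dec_all_lt (fun u => n (p1 u))
    (fun u i => exists y, y < p2 u /\ C ⟨⟨p1 u, i⟩, y⟩)); [computability |].
  apply (dec_ex_lt (fun v => p2 (p1 v)) (fun v y => C ⟨⟨p1 (p1 v), p2 v⟩, y⟩)); [computability |].
  apply (dec_subst C (fun w => ⟨⟨p1 (p1 (p1 w)), p2 (p1 w)⟩, p2 w⟩) HC); computability.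
- assert (H' : forall x i, P x i <-> exists y, C ⟨⟨x, i⟩, y⟩).
  { intros x i; rewrite <- H; now unpair. }
  intros x; split.
  + intros h.
    enough (E : exists b, forall i, i < n x -> exists y, y < b /\ C ⟨⟨x, i⟩, y⟩).
    { destruct E as [b Hb]; exists b; now unpair. }
    revert h; generalize (n x) as m; intros m; induction m as [| m IH]; intros h.
    * exists 0; lia.
    * destruct IH as [b Hb]; [auto |].
      destruct (proj1 (H' x m)) as [y Hy]; [auto |].
      exists (S (b + y)); intros i Hi.
      destruct (Nat.eq_dec i m) as [-> | ?]; [exists y; split; [lia | auto] |].
      destruct (Hb i) as (z & Hz & Hc); [lia |]; exists z; split; [lia | auto].
  + intros [b Hb] i Hi; apply H'; unpair; destruct (Hb i Hi) as (y & _ & Hy); eauto.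
Qed.

Ltac decidability :=
  cbn beta;
  match goal with
  | H : dec ?A |- dec ?A => exact H
  | |- dec (fun x => @?A x /\ @?B x) => apply (dec_and A B); decidability
  | |- dec (fun x => @?A x \/ @?B x) => apply (dec_or A B); decidability
  | |- dec (fun x => ~ @?A x) => apply (dec_not A); decidability
  | |- dec (fun x => @?f x < @?g x) => apply (dec_lt f g); computability
  | |- dec (fun x => @?f x <= @?g x) => apply (dec_le f g); computability
  | |- dec (fun x => @?f x = @?g x) => apply (dec_eq f g); computability
  | |- dec (fun x => forall i, i < @?n x -> @?P x i) =>
      apply (dec_all_lt n P); [computability | decidability]
  | |- dec (fun x => exists i, i < @?n x /\ @?P x i) =>
      apply (dec_ex_lt n P); [computability | decidability]
  | H : dec ?A |- dec (fun x => ?A (@?f x)) => apply (dec_subst A f H); computability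
  | _ => idtac
  end.

Ltac enumerability :=
  cbn beta;
  match goal with
  | H : re ?A |- re ?A => exact H
  | |- re (fun x => @?A x /\ @?B x) => apply (re_and A B); enumerability
  | |- re (fun x => @?A x \/ @?B x) => apply (re_or A B); enumerability
  | |- re (fun x => forall i, i < @?n x -> @?P x i) =>
      apply (re_all_lt n P); [computability | enumerability]
  | |- re (fun x => exists i, @?P x i) => apply (re_ex P); enumerability
  | H : re ?A |- re (fun x => ?A (@?f x)) => apply (re_subst A f H); computability
  | |- re (fun x => @?f x = @?g x) => apply re_dec; decidability
  | |- re (fun x => @?f x < @?g x) => apply re_dec; decidability
  | |- re (fun x => @?f x <= @?g x) => apply re_dec; decidability
  | _ => solve [eauto with computability]
  | _ => idtac
  end.

(** * The universal relation is recursively enumerable *)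

(** One step of the evaluation of the program number [e] at [x] with value [y],
    the clauses of [eval], where [M] supplies the values of the calls made.
    The primitive recursion clause calls [e] itself at the previous index, so
    that its calls are bounded in number. *)
Definition justified (M : nat -> Prop) (e x y : nat) : Prop :=
  (e = 0 /\ y = 0) \/ (e = 1 /\ y = S x) \/ (e = 2 /\ y = p1 x) \/ (e = 3 /\ y = p2 x) \/
  (exists c, exists d, e = 4 + 4 * ⟨c, d⟩ /\ M ⟨c, ⟨x, p1 y⟩⟩ /\ M ⟨d, ⟨x, p2 y⟩⟩) \/
  (exists c, exists d, e = 5 + 4 * ⟨c, d⟩ /\ exists u, M ⟨d, ⟨x, u⟩⟩ /\ M ⟨c, ⟨u, y⟩⟩) \/
  (exists c, exists d, e = 6 + 4 * ⟨c, d⟩ /\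
    ((p2 x = 0 /\ M ⟨c, ⟨p1 x, y⟩⟩) \/
     exists m, exists u, p2 x = S m /\ M ⟨e, ⟨⟨p1 x, m⟩, u⟩⟩ /\ M ⟨d, ⟨⟨p1 x, ⟨m, u⟩⟩, y⟩⟩)) \/
  (exists c, e = 7 + 4 * c /\ M ⟨c, ⟨⟨x, y⟩, 0⟩⟩ /\
    forall m, m < y -> exists k, M ⟨c, ⟨⟨x, m⟩, S k⟩⟩).

Lemma re_justified (M : nat -> nat -> Prop) e x y :
  re (fun u => M (p1 u) (p2 u)) -> computable e -> computable x -> computable y ->
  re (fun v => justified (M v) (e v) (x v) (y v)).
Proof.
intros HM He Hx Hy; unfold justified.
assert (HM' : forall f g, computable f -> computable g -> re (fun v => M (f v) (g v))).
{ intros f g Hf Hg.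
  apply (re_ext (fun v => M (p1 ⟨f v, g v⟩) (p2 ⟨f v, g v⟩))); [intros v; now unpair |].
  apply (re_subst (fun u => M (p1 u) (p2 u)) (fun v => ⟨f v, g v⟩) HM); computability. }
enumerability.
all: match goal with |- re (fun v => ?N (@?f v) (@?g v)) => apply (HM' f g); computability end.
Qed.

Lemma justified_mono (M N : nat -> Prop) e x y :
  (forall t, M t -> N t) -> justified M e x y -> justified N e x y.
Proof.
unfold justified; intros HMN
  [H | [H | [H | [H | [(c & d & E & H1 & H2) | [(c & d & E & u & H1 & H2) |
  [(c & d & E & [[E' H1] | (m & u & E' & H1 & H2)]) | (c & E & H1 & H2)]]]]]]].
1-4: tauto.
- do 4 right; left; exists c, d; auto.
- do 5 right; left; exists c, d; split; [exact E |]; exists u; auto.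
- do 6 right; left; exists c, d; auto.
- do 6 right; left; exists c, d; split; [exact E |]; right; exists m, u; auto.
- do 7 right; exists c; repeat split; auto.
  intros m Hm; destruct (H2 m Hm) as [k Hk]; eauto.
Qed.

Definition phi_at (t : nat) : Prop := phi (p1 t) (p1 (p2 t)) (p2 (p2 t)).

Lemma phi_at_encode c x y : phi_at ⟨encode c, ⟨x, y⟩⟩ <-> eval c x y.
Proof.
unfold phi_at; unpair; split.
- intros (d & E & H); now rewrite <- (encode_inj _ _ E).
- intros H; exists c; auto.
Qed.

Lemma justified_sound e x y : justified phi_at e x y -> phi e x y.
Proof.
unfold justified; intros
  [[-> ->] | [[-> ->] | [[-> ->] | [[-> ->] | [(c & d & -> & H1 & H2) |
  [(c & d & -> & u & H1 & H2) | [(c & d & -> & H1) | (c & -> & H1 & H2)]]]]]]].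
- exists Zero; cbn; auto.
- exists Succ; cbn; auto.
- exists Fst; cbn; auto.
- exists Snd; cbn; auto.
- destruct (encode_surj c) as [c' <-], (encode_surj d) as [d' <-].
  rewrite phi_at_encode in *; exists (Pair c' d'); split; [reflexivity |].
  exists (p1 y), (p2 y); repeat split; auto; symmetry; apply pair_surj.
- destruct (encode_surj c) as [c' <-], (encode_surj d) as [d' <-].
  rewrite phi_at_encode in *; exists (Comp c' d'); split; [reflexivity |].
  exists u; auto.
- destruct (encode_surj c) as [c' <-], (encode_surj d) as [d' <-].
  change (6 + 4 * ⟨encode c', encode d'⟩) with (encode (Prec c' d')) in *.
  exists (Prec c' d'); split; [reflexivity |].
  cbn [eval]; fold (p1 x) (p2 x).
  destruct H1 as [[E H] | (m & u & E & H1 & H2)]; rewrite phi_at_encode in *; rewrite E.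
  + exact H.
  + cbn [eval] in H1; fold (p1 ⟨p1 x, m⟩) (p2 ⟨p1 x, m⟩) in H1; unpair.
    exists u; auto.
- destruct (encode_surj c) as [c' <-]; rewrite phi_at_encode in *.
  exists (Mu c'); split; [reflexivity |]; split; [exact H1 |].
  intros m Hm; destruct (H2 m Hm) as [k Hk]; rewrite phi_at_encode in *; eauto.
Qed.

(** The calls of a value must occur strictly further down the list: this is what
    keeps a derivation from justifying itself in a circle. *)
Inductive derivation : list nat -> Prop :=
| derivation_nil : derivation []
| derivation_cons e x y l :
    justified (fun u => In u l) e x y -> derivation l -> derivation (⟨e, ⟨x, y⟩⟩ :: l).

Lemma derivation_sound l : derivation l -> forall t, In t l -> phi_at t.
Proof.
induction 1 as [| e x y l J _ IH]; [intros t [] |].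
intros t [<- | Ht]; [| auto].
unfold phi_at; unpair; apply justified_sound.
now apply (justified_mono (fun u => In u l)).
Qed.

Lemma derivation_app l l' : derivation l -> derivation l' -> derivation (l ++ l').
Proof.
induction 1 as [| e x y l J _ IH]; intros H'; [exact H' |].
cbn; constructor; [| auto].
apply (justified_mono (fun u => In u l)); [| exact J].
intros t Ht; apply in_or_app; auto.
Qed.

Definition derivable (t : nat) : Prop := exists l, derivation l /\ In t l.

Lemma derivable_justified l e x y :
  derivation l -> justified (fun u => In u l) e x y -> derivable ⟨e, ⟨x, y⟩⟩.
Proof. intros D J; eexists; split; [exact (derivation_cons _ _ _ _ J D) | now left]. Qed.

(** By induction on the program; the derivations of the calls are concatenated. *)
Lemma derivation_complete c : forall x y, eval c x y -> derivable ⟨encode c, ⟨x, y⟩⟩.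
Proof.
induction c as [| | | | c IHc d IHd | c IHc d IHd | c IHc d IHd | c IHc]; intros x y H.
1-4: apply (derivable_justified []); [constructor |]; unfold justified; cbn [encode];
  cbn [eval] in H; fold (p1 x) (p2 x) in H; tauto.
- destruct H as (a & b & Ha & Hb & ->).
  destruct (IHc _ _ Ha) as (l & D & I), (IHd _ _ Hb) as (l' & D' & I').
  apply (derivable_justified (l ++ l')); [now apply derivation_app |].
  do 4 right; left; exists (encode c), (encode d); unpair.
  split; [reflexivity |]; split; apply in_or_app; auto.
- destruct H as (u & Hu & Hy).
  destruct (IHc _ _ Hy) as (l & D & I), (IHd _ _ Hu) as (l' & D' & I').
  apply (derivable_justified (l ++ l')); [now apply derivation_app |].
  do 5 right; left; exists (encode c), (encode d).
  split; [reflexivity |]; exists u; split; apply in_or_app; auto.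
- cbn [eval] in H; fold (p1 x) (p2 x) in H; rewrite <- (pair_surj x).
  revert y H; generalize (p1 x) as a, (p2 x) as n; clear x.
  intros a n; induction n as [| m IH]; intros y H.
  + destruct (IHc _ _ H) as (l & D & I).
    apply (derivable_justified l _ _ _ D).
    do 6 right; left; exists (encode c), (encode d); unpair.
    split; [reflexivity |]; left; auto.
  + destruct H as (u & Hu & Hy).
    destruct (IH _ Hu) as (l & D & I), (IHd _ _ Hy) as (l' & D' & I').
    apply (derivable_justified (l ++ l')); [now apply derivation_app |].
    do 6 right; left; exists (encode c), (encode d); unpair.
    split; [reflexivity |]; right; exists m, u.
    split; [reflexivity |]; split; apply in_or_app; auto.
- destruct H as [H0 H].
  assert (E : exists l, derivation l /\
    forall m, m < y -> exists k, In ⟨encode c, ⟨⟨x, m⟩, S k⟩⟩ l).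
  { clear H0; induction y as [| y IH]; [exists []; split; [constructor | lia] |].
    destruct IH as (l & D & I); [auto |].
    destruct (H y) as [k Hk]; [lia |].
    destruct (IHc _ _ Hk) as (l' & D' & I').
    exists (l ++ l'); split; [now apply derivation_app |].
    intros m Hm; destruct (Nat.eq_dec m y) as [-> | ?].
    - exists k; apply in_or_app; auto.
    - destruct (I m) as [j Hj]; [lia |]; exists j; apply in_or_app; auto. }
  destruct E as (l & D & I), (IHc _ _ H0) as (l' & D' & I').
  apply (derivable_justified (l ++ l')); [now apply derivation_app |].
  do 7 right; exists (encode c).
  split; [reflexivity |]; split; [apply in_or_app; auto |].
  intros m Hm; destruct (I m Hm) as [k Hk]; exists k; apply in_or_app; auto.
Qed.

Lemma phi_at_derivable t : phi_at t <-> derivable t.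
Proof.
split.
- intros (c & E & H); rewrite <- (pair_surj t), <- (pair_surj (p2 t)), <- E.
  now apply derivation_complete.
- intros (l & D & I); exact (derivation_sound l D t I).
Qed.

Fixpoint code_list (l : list nat) : nat :=
  match l with [] => 0 | t :: l' => ⟨t, code_list l'⟩ end.

(** Past the end of the coded list the entries are [0], as both projections of
    [0] are [0], so a code does not determine the length of its list. *)
Definition entry (w i : nat) : nat := p1 (nat_rec (fun _ => nat) w (fun _ y => p2 y) i).

Lemma computable_entry w i :
  computable w -> computable i -> computable (fun v => entry (w v) (i v)).
Proof.
intros Hw Hi; unfold entry.
apply (computable_p1 (fun v => nat_rec (fun _ => nat) (w v) (fun _ y => p2 y) (i v))).
apply (computable_rec w (fun _ _ y => p2 y) i); computability.
Qed.

#[export] Hint Extern 2 (computable (fun x => entry (@?f x) (@?g x))) =>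
  apply (computable_entry f g); computability : computability.

Lemma entry_S t w i : entry ⟨t, w⟩ (S i) = entry w i.
Proof.
unfold entry; f_equal; induction i as [| i IH]; cbn [nat_rec nat_rect] in *.
- apply p2_pair.
- now rewrite IH.
Qed.

(** [w] codes the list of the first [n] entries; the entries after
    position [i] are those that may justify entry [i]. *)
Definition derivation_code (n w : nat) : Prop :=
  forall i, i < n ->
    justified (fun u => exists j, j < n /\ i < j /\ entry w j = u)
      (p1 (entry w i)) (p1 (p2 (entry w i))) (p2 (p2 (entry w i))).

Lemma derivation_code_sound n w :
  derivation_code n w -> forall i, i < n -> phi_at (entry w i).
Proof.
intros H i Hi; remember (n - i) as k eqn:Ek; revert i Hi Ek.
induction k as [k IH] using (well_founded_induction lt_wf); intros i Hi ->.
apply justified_sound; apply (justified_mono _ _ _ _ _) with (2 := H i Hi).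
intros t (j & Hj & Hij & <-); apply (IH (n - j)); lia.
Qed.

Lemma entry_code_list l t :
  In t l <-> exists i, i < length l /\ entry (code_list l) i = t.
Proof.
induction l as [| u l IH]; cbn [In code_list length].
- split; [intros [] | intros (i & Hi & _); lia].
- rewrite IH; split.
  + intros [-> | (i & Hi & E)]; [exists 0 | exists (S i)]; split; try lia.
    * apply p1_pair.
    * now rewrite entry_S.
  + intros ([| i] & Hi & E).
    * left; rewrite <- E; symmetry; apply p1_pair.
    * right; exists i; split; [lia |]; now rewrite entry_S in E.
Qed.

Lemma derivation_code_complete l :
  derivation l -> derivation_code (length l) (code_list l).
Proof.
induction 1 as [| e x y l J _ IH]; intros i Hi; cbn [length code_list] in *; [lia |].
destruct i as [| i].
- assert (E : entry ⟨⟨e, ⟨x, y⟩⟩, code_list l⟩ 0 = ⟨e, ⟨x, y⟩⟩) by apply p1_pair.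
  rewrite E; unpair.
  apply (justified_mono _ _ _ _ _) with (2 := J).
  intros t Ht; apply entry_code_list in Ht; destruct Ht as (j & Hj & Ej).
  exists (S j); rewrite entry_S; repeat split; [lia | lia | exact Ej].
- rewrite entry_S; apply (justified_mono _ _ _ _ _) with (2 := IH i ltac:(lia)).
  intros t (j & Hj & Hij & Ej).
  exists (S j); rewrite entry_S; repeat split; [lia | lia | exact Ej].
Qed.

(** A value exists exactly when some code of a derivation contains it, and
    validity of a code only involves bounded quantifiers and [justified]. *)
Lemma re_phi e x y :
  computable e -> computable x -> computable y -> re (fun v => phi (e v) (x v) (y v)).
Proof.
intros He Hx Hy.
apply (re_ext (fun v => phi_at ⟨e v, ⟨x v, y v⟩⟩)).
{ intros v; unfold phi_at; now unpair. }
apply (re_subst phi_at (fun v => ⟨e v, ⟨x v, y v⟩⟩)); [| computability].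
apply (re_ext (fun t => exists n w, derivation_code n w /\ exists i, i < n /\ entry w i = t)).
- intros t; split.
  + intros (n & w & H & i & Hi & <-); exact (derivation_code_sound n w H i Hi).
  + intros H; apply phi_at_derivable in H; destruct H as (l & D & I).
    exists (length l), (code_list l); split; [now apply derivation_code_complete |].
    now apply entry_code_list.
- unfold derivation_code; enumerability.
  apply (re_justified
    (fun v u => exists j, j < p2 (p1 (p1 v)) /\ p2 v < j /\ entry (p2 (p1 v)) j = u)).
  1: enumerability. all: computability.
Qed.

#[export] Hint Extern 2 (re (fun v => phi (@?e v) (@?x v) (@?y v))) =>
  apply (re_phi e x y); computability : computability.

(** * Arithmetical form of density *)

(** A single interval from [z1] to [z3] carries all the demands, so that one
    list of witnesses suffices for the whole condition. *)
Definition dense_off (n : nat) (R : nat -> nat -> Prop) : Prop :=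
  forall x y, R x y -> (forall c, c < n -> R c x \/ R y c) ->
  exists z1 z2 z3, R z1 x /\ R x z2 /\ R z2 y /\ R y z3 /\
    forall c, c < n -> R c z1 \/ R z3 c.

Lemma re_Sigma1 A : re A <-> Sigma0 1 A.
Proof.
split; intros (C & HC & H); exists C; split; auto; now apply dec_computable_set.
Qed.

Lemma Pi2_all P : re (fun u => P (p1 u) (p2 u)) -> Pi0 2 (fun x => forall y, P x y).
Proof.
intros H; exists (fun u => P (p1 u) (p2 u)); split; [now apply re_Sigma1 |].
intros x; split; intros h y; specialize (h y); now unpair.
Qed.

Lemma Pi2_ext A B : (forall x, A x <-> B x) -> Pi0 2 A -> Pi0 2 B.
Proof.
intros E (C & HC & H); exists C; split; [exact HC |].
intros x; rewrite <- E; apply H.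
Qed.

Lemma Pi2_subst A f : Pi0 2 A -> computable f -> Pi0 2 (fun x => A (f x)).
Proof.
intros (C & HC & H) Hf; apply re_Sigma1 in HC.
apply (Pi2_ext (fun x => forall y, C ⟨f x, y⟩)); [intros x; symmetry; apply H |].
apply Pi2_all, (re_subst C (fun u => ⟨f (p1 u), p2 u⟩) HC); computability.
Qed.

(** The axioms of linear orders and [dense_off], with every negated value
    replaced by the convergence to [0].  For total characteristic functions
    nothing changes, but now all clauses are recursively enumerable. *)
Definition LIN_clauses (e x y z : nat) : Prop :=
  phi e ⟨x, x⟩ 0 /\
  (phi e ⟨x, y⟩ 0 \/ phi e ⟨y, z⟩ 0 \/ phi e ⟨x, z⟩ 1) /\
  (phi e ⟨x, y⟩ 1 \/ x = y \/ phi e ⟨y, x⟩ 1).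

Definition dense_clause (e n x y : nat) : Prop :=
  phi e ⟨x, y⟩ 0 \/ (exists c, c < n /\ phi e ⟨c, x⟩ 0 /\ phi e ⟨y, c⟩ 0) \/
  exists z1, exists z2, exists z3,
    phi e ⟨z1, x⟩ 1 /\ phi e ⟨x, z2⟩ 1 /\ phi e ⟨z2, y⟩ 1 /\ phi e ⟨y, z3⟩ 1 /\
    forall c, c < n -> phi e ⟨c, z1⟩ 1 \/ phi e ⟨z3, c⟩ 1.

Lemma phi_fun e x y z : phi e x y -> phi e x z -> y = z.
Proof.
intros (c & <- & H) (d & E & H'); apply encode_inj in E; subst d.
exact (eval_fun _ _ _ _ H H').
Qed.

(** One universal quantifier [t] serves both as an argument of [phi e] and as a
    coded triple of points. *)
Lemma dense_LIN_clauses e n :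
  LIN e /\ dense_off n (ord e) <->
  forall t, (phi e t 0 \/ phi e t 1) /\
    LIN_clauses e (p1 t) (p1 (p2 t)) (p2 (p2 t)) /\ dense_clause e n (p1 t) (p1 (p2 t)).
Proof.
assert (N : forall t, phi e t 0 -> ~ phi e t 1).
{ intros t H0 H1; discriminate (phi_fun _ _ _ _ H0 H1). }
split.
- intros [[T [[I Tr] L]] D] t; split; [apply T |].
  generalize (p1 t) as x, (p1 (p2 t)) as y, (p2 (p2 t)) as z; intros x y z; clear t.
  unfold ord in *; split; [split; [| split] |].
  + destruct (T ⟨x, x⟩) as [? | h]; [assumption | destruct (I x h)].
  + destruct (T ⟨x, y⟩) as [? | h]; [tauto |].
    destruct (T ⟨y, z⟩) as [? | h']; [tauto |].
    right; right; exact (Tr _ _ _ h h').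
  + apply L.
  + destruct (T ⟨x, y⟩) as [? | h]; [now left | right].
    destruct (classic (exists c, c < n /\ phi e ⟨c, x⟩ 0 /\ phi e ⟨y, c⟩ 0)) as [h' | h'];
      [now left | right].
    apply D; [exact h |].
    intros c Hc; destruct (T ⟨c, x⟩) as [H0 | ?]; [| now left].
    destruct (T ⟨y, c⟩) as [H0' | ?]; [| now right].
    destruct h'; eauto.
- intros H.
  assert (T : forall t, phi e t 0 \/ phi e t 1) by (intros t; apply H).
  assert (L : forall x y z, LIN_clauses e x y z).
  { intros x y z; destruct (H ⟨x, ⟨y, z⟩⟩) as (_ & h & _); now unpair. }
  assert (D : forall x y, dense_clause e n x y).
  { intros x y; destruct (H ⟨x, ⟨y, 0⟩⟩) as (_ & _ & h); now unpair. }
  clear H; unfold ord; split; [split; [exact T | split; [split |]] |].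
  + intros x h; destruct (L x x x) as [h' _]; exact (N _ h' h).
  + intros x y z h h'; destruct (L x y z) as (_ & [h0 | [h0 | h0]] & _); auto;
      destruct (N _ h0); assumption.
  + intros x y; apply (L x y 0).
  + intros x y h F; destruct (D x y) as [h0 | [(c & Hc & h0 & h1) | h0]]; auto.
    * destruct (N _ h0 h).
    * destruct (F c Hc) as [h2 | h2]; [destruct (N _ h0 h2) | destruct (N _ h1 h2)].
Qed.

Lemma dense_LIN_Pi2 : Pi0 2 (fun v => LIN (p1 v) /\ dense_off (p2 v) (ord (p1 v))).
Proof.
eapply Pi2_ext; [intros v; symmetry; apply dense_LIN_clauses |].
apply (Pi2_all (fun v t => (phi (p1 v) t 0 \/ phi (p1 v) t 1) /\
    LIN_clauses (p1 v) (p1 t) (p1 (p2 t)) (p2 (p2 t)) /\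
    dense_clause (p1 v) (p2 v) (p1 t) (p1 (p2 t)))).
unfold LIN_clauses, dense_clause; enumerability.
Qed.

(** * Homogeneity and density *)

Definition homogeneous_over (R : nat -> nat -> Prop) (a : list nat) : Prop :=
  forall (F G : list nat) (f : nat -> nat),
    incl a F -> incl a G ->
    order_iso R (fun x => In x F) (fun y => In y G) f ->
    (forall x, In x a -> f x = x) ->
    exists g, automorphism R g /\ forall x, In x F -> g x = f x.

Section HomogeneousDense.

Variables (n : nat) (R : nat -> nat -> Prop).
Hypothesis Rlin : linear_order R.

Let Rirr x : ~ R x x.
Proof. apply Rlin. Qed.

Let Rtr x y z : R x y -> R y z -> R x z.
Proof. apply Rlin. Qed.

Let Rtot x y : R x y \/ x = y \/ R y x.
Proof. apply Rlin. Qed.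

(** If no [c < n] separates [x] from [y], the map [x |-> y] extends to an
    automorphism [g] fixing every [c < n].  Then [g y] is above [y] in the same
    cut, the inverse direction gives a point below [x], and the automorphism
    that fixes [x] and sends [y] to [g y] must pull [y] back to a point between
    [x] and [y]. *)
Lemma homogeneous_dense_off : homogeneous_over R (seq 0 n) -> dense_off n R.
Proof.
intros H x y Hxy Hc.
assert (ext : forall F f, incl (seq 0 n) F -> (forall c, c < n -> f c = c) ->
  (forall s t, In s F -> In t F -> R s t -> R (f s) (f t)) ->
  exists g, automorphism R g /\ forall s, In s F -> g s = f s).
{ intros F f HF Hf Hm; apply (H F (map f F)); auto.
  - intros c Hi; rewrite <- (Hf c); [apply in_map, HF, Hi | apply in_seq in Hi; lia].
  - split; [| split; [| split]].
    + intros s; apply in_map.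
    + intros t Ht; apply in_map_iff in Ht; destruct Ht as (s & E & Hs); eauto.
    + intros s t Hs Ht E; destruct (Rtot s t) as [h | [h | h]]; auto; exfalso;
        apply Hm in h; auto; rewrite E in h; exact (Rirr _ h).
    + intros s s' Hs Hs'; split; [auto |].
      intros h; destruct (Rtot s s') as [h' | [<- | h']]; auto; [destruct (Rirr _ h) |].
      apply Hm in h'; auto; destruct (Rirr (f s)); eauto.
  - intros c Hi; apply Hf; apply in_seq in Hi; lia. }
assert (aut : forall g, automorphism R g ->
  (forall s t, R s t <-> R (g s) (g t)) /\ forall t, exists s, g s = t).
{ intros g (_ & S & _ & E); split; [intros s t; now apply E |].
  intros t; destruct (S t I) as (s & _ & h); eauto. }
assert (cut : forall c, c < n -> R c x /\ R c y \/ R x c /\ R y c).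
{ intros c Hn; destruct (Hc c Hn); eauto. }
assert (move : forall u v, (forall c, c < n -> R c u /\ R c v \/ R u c /\ R v c) ->
  exists g, (forall s t, R s t <-> R (g s) (g t)) /\ (forall c, c < n -> g c = c) /\ g u = v).
{ intros u v Huv.
  set (f := fun t => if Nat.eq_dec t u then v else t).
  assert (fu : f u = v) by (unfold f; destruct (Nat.eq_dec u u); congruence).
  assert (fc : forall c, c < n -> f c = c).
  { intros c Hn; unfold f; destruct (Nat.eq_dec c u) as [-> |]; [| reflexivity].
    destruct (Huv u Hn) as [[h _] | [h _]]; destruct (Rirr _ h). }
  destruct (ext (u :: seq 0 n) f) as (g & Hg & E); auto.
  - now apply incl_tl, incl_refl.
  - intros s t [<- | Hs] [<- | Ht] h; rewrite ?fu; try destruct (Rirr _ h);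
      try apply in_seq in Hs; try apply in_seq in Ht; rewrite ?fc by lia; auto.
    + destruct (Huv t) as [[h' _] | h']; [lia | | apply h']; destruct (Rirr u); eauto.
    + destruct (Huv s) as [h' | [h' _]]; [lia | apply h' |]; destruct (Rirr u); eauto.
  - exists g; destruct (aut g Hg) as [Hm _]; split; [exact Hm |]; split.
    + intros c Hn; rewrite E; [auto | right; apply in_seq; lia].
    + rewrite E; [auto | now left]. }
destruct (move x y cut) as (g & Hg & gc & gx).
destruct (move y x) as (g' & Hg' & gc' & gy').
{ intros c Hn; destruct (cut c Hn); tauto. }
set (z3 := g y); set (z1 := g' x).
assert (H3 : R y z3) by (rewrite <- gx at 1; exact (proj1 (Hg x y) Hxy)).
assert (H1 : R z1 x) by (rewrite <- gy'; exact (proj1 (Hg' x y) Hxy)).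
assert (cut3 : forall c, c < n -> R c y -> R c z3).
{ intros c Hn h; exact (Rtr _ _ _ h H3). }
assert (cut3' : forall c, c < n -> R y c -> R z3 c).
{ intros c Hn h; rewrite <- (gc c Hn); exact (proj1 (Hg y c) h). }
assert (cut1 : forall c, c < n -> R c x -> R c z1).
{ intros c Hn h; rewrite <- (gc' c Hn); exact (proj1 (Hg' c x) h). }
assert (Z2 : exists z2, R x z2 /\ R z2 y).
{ set (f := fun t => if Nat.eq_dec t y then z3 else t).
  assert (fy : f y = z3) by (unfold f; destruct (Nat.eq_dec y y); congruence).
  assert (fo : forall t, t <> y -> f t = t).
  { intros t Ht; unfold f; destruct (Nat.eq_dec t y); congruence. }
  assert (xy : x <> y) by (intros ->; exact (Rirr _ Hxy)).
  assert (cy : forall c, c < n -> c <> y).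
  { intros c Hn ->; destruct (cut y Hn) as [[_ h] | [_ h]]; exact (Rirr _ h). }
  destruct (ext (x :: y :: seq 0 n) f) as (h & Hh & E).
  - now apply incl_tl, incl_tl, incl_refl.
  - intros c Hn; auto.
  - assert (yx : ~ R y x) by (intros h'; exact (Rirr _ (Rtr _ _ _ h' Hxy))).
    intros s t [<- | [<- | Hs]] [<- | [<- | Ht]] h; try apply in_seq in Hs;
      try apply in_seq in Ht; rewrite ?fy; rewrite ?fo by (auto; apply cy; lia);
      try destruct (Rirr _ h); eauto; try tauto.
    apply cut3'; [lia | exact h].
  - destruct (aut h Hh) as [Hm S]; destruct (S y) as [w Hw].
    exists w; rewrite (Hm x w), (Hm w y), Hw, (E x), (E y), (fo x xy), fy; cbn; auto. }
destruct Z2 as (z2 & H2 & H2'); exists z1, z2, z3; repeat split; auto.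
intros c Hn; destruct (Hc c Hn); auto.
Qed.


End HomogeneousDense.

(** The key [k] lets pairs be compared by one coordinate. *)
Lemma finite_max {T : Type} (R : nat -> nat -> Prop) (k : T -> nat) (P : T -> Prop) l :
  linear_order R -> (exists a, In a l /\ P a) ->
  exists a, In a l /\ P a /\ forall b, In b l -> P b -> k b = k a \/ R (k b) (k a).
Proof.
intros [[Rirr Rtr] Rtot]; induction l as [| a l IH]; intros (b & Hb & HP); [destruct Hb |].
destruct (classic (exists c, In c l /\ P c)) as [h | h].
- destruct (IH h) as (m & Hm & Pm & M).
  destruct (classic (P a /\ R (k m) (k a))) as [[Pa Hma] | Hma].
  + exists a; split; [now left |]; split; [exact Pa |].
    intros c [<- | Hc] Pc; [now left | right].
    destruct (M c Hc Pc) as [-> | h']; [exact Hma | exact (Rtr _ _ _ h' Hma)].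
  + exists m; split; [now right |]; split; [exact Pm |].
    intros c [<- | Hc] Pc; [| auto].
    destruct (Rtot (k a) (k m)) as [? | [? | ?]]; auto; tauto.
- assert (forall c, In c (a :: l) -> P c -> c = a).
  { intros c [<- | Hc] Pc; [reflexivity | destruct h; eauto]. }
  exists a; split; [now left |]; split; [now rewrite <- (H b Hb HP) |].
  intros c Hc Pc; left; now rewrite (H c Hc Pc).
Qed.

Lemma linear_order_flip (R : nat -> nat -> Prop) :
  linear_order R -> linear_order (fun x y => R y x).
Proof.
intros [[Rirr Rtr] Rtot]; split; [split |].
- exact Rirr.
- intros x y z h h'; exact (Rtr _ _ _ h' h).
- intros x y; destruct (Rtot x y) as [? | [? | ?]]; auto.
Qed.

Lemma dense_off_flip n (R : nat -> nat -> Prop) :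
  dense_off n R -> dense_off n (fun x y => R y x).
Proof.
intros D x y Hxy F; destruct (D y x Hxy) as (z1 & z2 & z3 & H).
- intros c Hc; destruct (F c Hc); auto.
- exists z3, z2, z1; repeat split; try apply H; intros c Hc.
  destruct H as (_ & _ & _ & _ & H); destruct (H c Hc); auto.
Qed.

(** A finite partial isomorphism given by its graph; functionality and
    injectivity follow from the order condition by totality and
    irreflexivity. *)
Definition partial_iso (n : nat) (R : nat -> nat -> Prop) (p : list (nat * nat)) : Prop :=
  (forall a b, In a p -> In b p -> (R (fst a) (fst b) <-> R (snd a) (snd b))) /\
  forall c, c < n -> In (c, c) p.

(** [y] lies in the cut that the image of [x] must lie in. *)
Definition fits (R : nat -> nat -> Prop) (p : list (nat * nat)) (x y : nat) : Prop :=
  forall a, In a p -> (R (fst a) x -> R (snd a) y) /\ (R x (fst a) -> R y (snd a)).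

(** Here [y = x] is not a possible image, as some pair [(u, v)] has [u] below [x]
    but not [v]; the one with [u] greatest is taken.  No [c < n], being fixed, can
    lie between [u] and [v], so density applies there and yields [z3] just above
    [v].  The image is to lie between [v] and [v'], where [u'] is the least
    point above [x] in the domain.  If no [c < n] lies between [v] and [v'],
    density gives such a point; if one does, it is above [z3], and [z3] itself
    serves. *)
Lemma fits_shifted n (R : nat -> nat -> Prop) p x a :
  linear_order R -> dense_off n R -> partial_iso n R p ->
  In a p -> R (fst a) x -> ~ R (snd a) x -> exists y, fits R p x y.
Proof.
intros L D [Hp Hc] Ha Hax Hax'.
destruct (finite_max R fst (fun b => R (fst b) x) p L) as ([u v] & Hl & Hux & Ml); [eauto |].
cbn in Hux.
pose proof L as [[Rirr Rtr] Rtot].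
assert (Hvx : R x v \/ x = v).
{ destruct (Rtot x v) as [? | [? | h]]; auto; destruct Hax'.
  destruct (Ml a Ha Hax) as [E | h'].
  - destruct (Rtot (snd a) v) as [h'' | [E' | h'']]; [eauto | congruence |].
    apply (Hp (u, v) a) in h''; auto; cbn in h'', E; rewrite E in h''; destruct (Rirr _ h'').
  - apply (Hp a (u, v)) in h'; auto; eauto. }
assert (Huv : R u v) by (destruct Hvx as [? | <-]; eauto).
assert (free : forall c, c < n -> R c u \/ R v c).
{ intros c Hn; destruct (Rtot c u) as [h | [-> | h]]; [now left | exfalso |].
  - destruct (Rtot u v) as [h | [h | h]].
    + apply (Hp (u, u) (u, v)) in h; auto; destruct (Rirr _ h).
    + subst; destruct (Rirr _ Huv).
    + destruct (Rirr u); eauto.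
  - right; apply (Hp (u, v) (c, c)) in h; auto. }
destruct (D u v Huv free) as (z1 & _ & z3 & Hz1 & _ & _ & Hz3 & Hz).
assert (low : forall y, R v y -> forall b, In b p -> R (fst b) x -> R (snd b) y).
{ intros y Hy b Hb Hbx; destruct (Ml b Hb Hbx) as [E | h].
  - destruct (Rtot (snd b) v) as [h | [-> | h]]; [eauto | exact Hy |].
    apply (Hp (u, v) b) in h; auto; cbn in h, E; rewrite E in h; destruct (Rirr _ h).
  - apply (Hp b (u, v)) in h; auto; eauto. }
destruct (classic (exists b, In b p /\ R x (fst b))) as [Hb | Hb].
2: { exists z3; intros b Ib; split; [now apply low |].
     intros h; destruct Hb; eauto. }
destruct (finite_max (fun s t => R t s) fst (fun b => R x (fst b)) p
  (linear_order_flip R L) Hb) as ([u' v'] & Hr & Hxu & Mr); cbn in Hxu.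
assert (high : forall y, R y v' -> forall b, In b p -> R x (fst b) -> R y (snd b)).
{ intros y Hy b Ib Hbx; destruct (Mr b Ib Hbx) as [E | h].
  - destruct (Rtot (snd b) v') as [h | [-> | h]]; [| exact Hy | eauto].
    apply (Hp b (u', v')) in h; auto; cbn in h, E; rewrite E in h; destruct (Rirr _ h).
  - apply (Hp (u', v') b) in h; auto; eauto. }
assert (Hvv : R v v') by (apply (Hp (u, v) (u', v')); cbn; eauto).
enough (E : exists y, R v y /\ R y v').
{ destruct E as (y & Hy & Hy'); exists y; intros b Ib; split; auto. }
destruct (classic (forall c, c < n -> R c v \/ R v' c)) as [F | F].
- destruct (D v v' Hvv F) as (_ & z2 & _ & _ & H & H' & _); eauto.
- apply not_all_ex_not in F; destruct F as [c F].
  apply imply_to_and in F; destruct F as [Hn F].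
  exists z3; split; [exact Hz3 |].
  assert (Hvc : R v c).
  { destruct (free c Hn) as [h |]; [| assumption].
    destruct F; left; eauto. }
  assert (Hcv : c = v' \/ R c v') by (destruct (Rtot c v') as [? | [? | ?]]; tauto).
  assert (Hzc : R z3 c).
  { destruct (Hz c Hn) as [h |]; [| assumption].
    exfalso; apply (Rirr c); eauto 10. }
  destruct Hcv as [<- | h]; eauto.
Qed.

(** If [x] fits into its own cut, [x] is sent to itself.  If not, the images are
    shifted upwards or downwards; the second case is the first one in the
    reversed order. *)
Lemma partial_iso_forth n (R : nat -> nat -> Prop) p x :
  linear_order R -> dense_off n R -> partial_iso n R p ->
  exists y, partial_iso n R ((x, y) :: p).
Proof.
intros L D Hp.
pose proof L as [[Rirr Rtr] Rtot].
destruct (classic (exists y, In (x, y) p)) as [[y Hy] | Hx].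
{ exists y; destruct Hp as [Hp Hc]; split; [| intros c Hn; right; auto].
  assert (H : forall a, In a ((x, y) :: p) -> In a p) by (intros a [<- | ?]; auto).
  intros a b Ha Hb; auto. }
enough (E : exists y, fits R p x y).
{ destruct E as [y Hy]; exists y; destruct Hp as [Hp Hc].
  split; [| intros c Hn; right; auto].
  assert (H : forall a, In a p -> fst a <> x).
  { intros [u v] Ha E; cbn in E; subst u; destruct Hx; eauto. }
  intros a b [<- | Ha] [<- | Hb]; cbn; auto.
  - split; intros h; [destruct (Rirr _ h) | destruct (Rirr _ h)].
  - split; [now apply Hy |].
    intros h; destruct (Rtot x (fst b)) as [? | [E | h']]; auto.
    + destruct (H b Hb); auto.
    + apply Hy in h'; auto; destruct (Rirr y); eauto.
  - split; [now apply Hy |].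
    intros h; destruct (Rtot (fst a) x) as [? | [E | h']]; auto.
    + destruct (H a Ha E).
    + apply Hy in h'; auto; destruct (Rirr y); eauto. }
destruct (classic (exists a, In a p /\ R (fst a) x /\ ~ R (snd a) x))
  as [(a & Ha & h & h') | Hup].
{ exact (fits_shifted n R p x a L D Hp Ha h h'). }
destruct (classic (exists a, In a p /\ R x (fst a) /\ ~ R x (snd a)))
  as [(a & Ha & h & h') | Hdown].
{ destruct (fits_shifted n (fun s t => R t s) p x a) as [y Hy]; auto.
  - now apply linear_order_flip.
  - now apply dense_off_flip.
  - destruct Hp as [Hp Hc]; split; auto; intros b b' Hb Hb'; now apply Hp.
  - exists y; intros b Hb; destruct (Hy b Hb); auto. }
exists x; intros a Ha; split; intros h; apply NNPP; intros h'; [apply Hup | apply Hdown]; eauto.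
Qed.

Definition swap_pairs (p : list (nat * nat)) : list (nat * nat) :=
  map (fun a => (snd a, fst a)) p.

Lemma in_swap_pairs p x y : In (x, y) (swap_pairs p) <-> In (y, x) p.
Proof.
unfold swap_pairs; rewrite in_map_iff; split.
- intros ([u v] & E & H); injection E as <- <-; exact H.
- intros H; exists (y, x); auto.
Qed.

Lemma partial_iso_swap n R p : partial_iso n R (swap_pairs p) <-> partial_iso n R p.
Proof.
split; intros [Hp Hc]; split.
- intros [u v] [u' v'] Ha Hb; symmetry; apply (Hp (v, u) (v', u')); now apply in_swap_pairs.
- intros c Hn; apply in_swap_pairs; auto.
- intros [u v] [u' v'] Ha Hb; symmetry; rewrite in_swap_pairs in Ha, Hb;
    apply (Hp (v, u) (v', u')); auto.
- intros c Hn; apply in_swap_pairs; auto.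
Qed.

Lemma partial_iso_back_and_forth n (R : nat -> nat -> Prop) p x :
  linear_order R -> dense_off n R -> partial_iso n R p ->
  exists q, partial_iso n R q /\ incl p q /\
    (exists y, In (x, y) q) /\ exists y, In (y, x) q.
Proof.
intros L D Hp.
destruct (partial_iso_forth n R p x L D Hp) as [y Hy].
destruct (partial_iso_forth n R (swap_pairs ((x, y) :: p)) x L D) as [z Hz].
{ now apply partial_iso_swap. }
exists ((z, x) :: (x, y) :: p); split; [now apply partial_iso_swap |].
split; [now apply incl_tl, incl_tl, incl_refl |].
split; eexists; cbn; eauto.
Qed.

(** Stage [k + 1] of the chain puts [k] into the domain and into the range, so
    the union of the chain is an automorphism. *)
Lemma dense_off_homogeneous n (R : nat -> nat -> Prop) :
  linear_order R -> dense_off n R -> homogeneous_over R (seq 0 n).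
Proof.
intros L D F G f HF HG (_ & _ & _ & Hm) Hf.
set (Q := {p | partial_iso n R p}).
assert (start : partial_iso n R (map (fun u => (u, f u)) F)).
{ split.
  - intros a b Ha Hb; apply in_map_iff in Ha, Hb.
    destruct Ha as (u & <- & Hu), Hb as (v & <- & Hv); now apply Hm.
  - intros c Hn; apply in_map_iff; exists c; split.
    + rewrite Hf; [reflexivity | apply in_seq; lia].
    + apply HF, in_seq; lia. }
assert (step : forall (p : Q) x, {q : Q | incl (proj1_sig p) (proj1_sig q) /\
  (exists y, In (x, y) (proj1_sig q)) /\ exists y, In (y, x) (proj1_sig q)}).
{ intros [p Hp] x; apply constructive_indefinite_description.
  destruct (partial_iso_back_and_forth n R p x L D Hp) as (q & Hq & H).
  exists (exist _ q Hq); exact H. }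
set (chain := fix chain k : Q := match k with
  | 0 => exist _ _ start
  | S k => proj1_sig (step (chain k) k) end).
set (P := fun k => proj1_sig (chain k)).
assert (mono : forall k j, k <= j -> incl (P k) (P j)).
{ intros k j H; induction H as [| j _ IH]; [apply incl_refl |].
  eapply incl_tran; [exact IH |].
  exact (proj1 (proj2_sig (step (chain j) j))). }
assert (comp : forall k j a b, In a (P k) -> In b (P j) ->
  (R (fst a) (fst b) <-> R (snd a) (snd b))).
{ intros k j a b Ha Hb; apply (proj1 (proj2_sig (chain (k + j)))).
  - apply (mono k (k + j)); [lia | exact Ha].
  - apply (mono j (k + j)); [lia | exact Hb]. }
assert (dom : forall x, {y | exists k, In (x, y) (P k)}).
{ intros x; apply constructive_indefinite_description.
  destruct (proj1 (proj2 (proj2_sig (step (chain x) x)))) as [y Hy].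
  exists y, (S x); exact Hy. }
set (g := fun x => proj1_sig (dom x)).
assert (Hg : forall x, exists k, In (x, g x) (P k)) by (intros x; exact (proj2_sig (dom x))).
destruct L as [[Rirr Rtr] Rtot].
assert (Rg : forall x x', R x x' <-> R (g x) (g x')).
{ intros x x'; destruct (Hg x) as [k Hk], (Hg x') as [j Hj].
  exact (comp k j _ _ Hk Hj). }
assert (graph : forall k x y, In (x, y) (P k) -> g x = y).
{ intros k x y H; destruct (Hg x) as [j Hj].
  destruct (Rtot (g x) y) as [h | [h | h]]; [| exact h |]; exfalso; apply (Rirr x).
  - exact (proj2 (comp j k _ _ Hj H) h).
  - exact (proj2 (comp k j _ _ H Hj) h). }
exists g; split; [split; [auto | split; [| split]] |].
- intros y _; destruct (proj2 (proj2 (proj2_sig (step (chain y) y)))) as [x Hx].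
  exists x; split; [exact I | apply (graph (S y)); exact Hx].
- intros x x' _ _ E; destruct (Rtot x x') as [h | [h | h]]; [| exact h |]; exfalso;
    apply Rg in h; rewrite E in h; exact (Rirr _ h).
- auto.
- intros x Hx; apply (graph 0); cbn; apply in_map_iff; eauto.
Qed.

(** * Upper bounds *)

Lemma UHL_dense e : UHL e <-> LIN e /\ dense_off 0 (ord e).
Proof.
split; intros [L H]; (split; [exact L |]).
- apply homogeneous_dense_off; [apply L |].
  intros F G f _ _ Hf _; exact (H F G f Hf).
- intros F G f Hf; apply (dense_off_homogeneous 0 (ord e) (proj2 L) H F G f); auto;
    intros x [].
Qed.

Lemma WUL_dense e : WUL e <-> LIN e /\ exists n, dense_off n (ord e).
Proof.
split; intros [L H]; (split; [exact L |]).
- destruct H as [a H].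
  (* Homogeneity passes from [a] to the larger initial segment. *)
  exists (S (list_max a)).
  apply homogeneous_dense_off; [apply L |].
  assert (Ha : incl a (seq 0 (S (list_max a)))).
  { intros x Hx; apply in_seq.
    pose proof (proj1 (list_max_le a _) (le_n _)) as M.
    rewrite Forall_forall in M; specialize (M x Hx); lia. }
  intros F G f HF HG Hf Hfix; apply (H F G f); auto.
  + exact (incl_tran Ha HF).
  + exact (incl_tran Ha HG).
- destruct H as [n H]; exists (seq 0 n); exact (dense_off_homogeneous n _ (proj2 L) H).
Qed.

Lemma UHL_Pi2 : Pi0 2 UHL.
Proof.
apply (Pi2_ext (fun e => LIN (p1 ⟨e, 0⟩) /\ dense_off (p2 ⟨e, 0⟩) (ord (p1 ⟨e, 0⟩)))).
- intros e; unpair; symmetry; apply UHL_dense.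
- apply (Pi2_subst (fun v => LIN (p1 v) /\ dense_off (p2 v) (ord (p1 v))) (fun e => ⟨e, 0⟩)
    dense_LIN_Pi2); computability.
Qed.

Lemma WUL_Sigma3 : Sigma0 3 WUL.
Proof.
exists (fun v => LIN (p1 v) /\ dense_off (p2 v) (ord (p1 v))); split; [exact dense_LIN_Pi2 |].
intros e; rewrite WUL_dense; split.
- intros (L & n & H); exists n; now unpair.
- intros [n H]; unpair; destruct H; eauto.
Qed.

(** * Orders built by insertion *)

(** Decides whether [a] is below or equal to [b].  The later one of the two is
    replaced by its parent, immediately above which it was placed: for
    [a < b], [a] is below [b] iff [a] is below or equal to [par b], and for
    [b < a], iff [b] is not below or equal to [par a].  Each negation
    flips the sign [s], which keeps the recursion iterative; [k] is fuel. *)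
Fixpoint run (par : nat -> nat) (k s a b : nat) : nat :=
  match k with
  | 0 => s
  | S j => if a =? b then s
           else if a <? b then run par j s a (par b)
           else run par j (1 - s) b (par a)
  end.

Definition below (par : nat -> nat) (a b : nat) : Prop :=
  run par (a + b) 1 a b = 1 /\ a <> b.

Section Insertion.

Variable par : nat -> nat.
Hypothesis par_lt : forall n, 0 < n -> par n < n.

Lemma run_refl k s a : run par k s a a = s.
Proof. destruct k; cbn; [reflexivity |]; now rewrite Nat.eqb_refl. Qed.

Lemma run_fuel k : forall j s a b, a + b <= k -> a + b <= j -> run par k s a b = run par j s a b.
Proof.
induction k as [| k IH]; intros j s a b Hk Hj.
- replace a with 0 by lia; replace b with 0 by lia; now rewrite !run_refl.
- destruct j as [| j].
  + replace a with 0 by lia; replace b with 0 by lia; now rewrite !run_refl.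
  + cbn [run]; destruct (Nat.eqb_spec a b) as [| E]; [reflexivity |].
    destruct (Nat.ltb_spec a b).
    * pose proof (par_lt b ltac:(lia)); apply IH; lia.
    * pose proof (par_lt a ltac:(lia)); apply IH; lia.
Qed.

Lemma run_sign k : forall s a b, s <= 1 ->
  run par k s a b <= 1 /\ run par k (1 - s) a b = 1 - run par k s a b.
Proof.
induction k as [| k IH]; intros s a b Hs; cbn [run]; [auto |].
destruct (a =? b); [auto |]; destruct (a <? b); [auto |].
destruct (IH (1 - s) b (par a)); [lia | auto].
Qed.

Let le (a b : nat) : Prop := a = b \/ below par a b.

Lemma below_irrefl a : ~ below par a a.
Proof. intros [_ H]; auto. Qed.

Lemma below_later a b : a < b -> (below par a b <-> le a (par b)).
Proof.
intros H; unfold le, below.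
assert (E : run par (a + b) 1 a b = run par (a + par b) 1 a (par b)).
{ pose proof (par_lt b ltac:(lia)).
  destruct b as [| b]; [lia |].
  rewrite <- plus_n_Sm; cbn [run].
  destruct (Nat.eqb_spec a (S b)); [lia |]; destruct (Nat.ltb_spec a (S b)); [| lia].
  apply run_fuel; lia. }
rewrite E; destruct (Nat.eq_dec a (par b)) as [<- |]; [| intuition lia].
rewrite run_refl; intuition lia.
Qed.

Lemma below_not a b : a <> b -> (below par a b <-> ~ below par b a).
Proof.
assert (H : forall a b, a < b -> (below par b a <-> ~ below par a b)).
{ clear a b; intros a b H; rewrite (below_later a b H); unfold below.
  assert (E : run par (b + a) 1 b a = 1 - run par (a + par b) 1 a (par b)).
  { pose proof (par_lt b ltac:(lia)).
    destruct b as [| b]; [lia |]; cbn [Nat.add run].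
    destruct (Nat.eqb_spec (S b) a); [lia |]; destruct (Nat.ltb_spec (S b) a); [lia |].
    rewrite <- (proj2 (run_sign (a + par (S b)) 1 a (par (S b)) ltac:(lia))).
    apply run_fuel; lia. }
  pose proof (proj1 (run_sign (a + par b) 1 a (par b) ltac:(lia))).
  rewrite E; unfold le, below.
  destruct (Nat.eq_dec a (par b)) as [<- |]; [rewrite run_refl in *; intuition lia |].
  intuition lia. }
intros Hab; destruct (le_lt_dec a b) as [h | h].
- assert (h' : a < b) by lia; rewrite (H a b h'); tauto.
- now apply H.
Qed.

(** Induction on the sum of the three points: whichever of them was inserted last
    is traded for its parent. *)
Lemma below_trans a b c : below par a b -> below par b c -> below par a c.
Proof.
enough (H : forall n a b c, a + b + c < n -> le a b -> le b c -> le a c).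
{ intros Hab Hbc.
  destruct (H (S (a + b + c)) a b c) as [<- |]; unfold le; auto.
  destruct (proj1 (below_not a b (proj2 Hab)) Hab Hbc). }
clear a b c.
assert (le_not : forall a b, ~ below par b a -> le a b).
{ intros a b h; destruct (Nat.eq_dec a b) as [| E]; [now left | right].
  now apply below_not. }
assert (not_le : forall a b, below par b a -> ~ le a b).
{ intros a b h [<- | h']; [exact (below_irrefl _ h) |].
  exact (proj1 (below_not b a (proj2 h)) h h'). }
induction n as [| n IH]; intros a b c Hn; [lia |].
intros [<- | Hab] Hbc; [exact Hbc |].
destruct Hbc as [<- | Hbc]; [now right |].
assert (a <> b) by apply Hab; assert (b <> c) by apply Hbc.
destruct (Nat.eq_dec a c) as [| Hac]; [now left |].
assert (M : (a < c /\ b < c) \/ (b < a /\ c < a) \/ (a < b /\ c < b)) by lia.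
destruct M as [[h h'] | [[h h'] | [h h']]].
- right; apply (below_later a c h); apply (below_later b c h') in Hbc.
  pose proof (par_lt c ltac:(lia)); apply (IH a b); [lia | now right | exact Hbc].
- apply le_not; rewrite (below_later c a h').
  intros Hc; pose proof (par_lt a ltac:(lia)).
  apply (not_le b a Hab), or_intror, (below_later b a h).
  apply (IH b c); [lia | now right | exact Hc].
- pose proof (par_lt b ltac:(lia)).
  apply (below_later a b h) in Hab.
  apply (IH a (par b)); [lia | exact Hab |].
  apply le_not; intros Hc; apply (not_le c b Hbc), or_intror, (below_later c b h').
  now right.
Qed.

Lemma below_linear : linear_order (below par).
Proof.
split; [split |].
- exact below_irrefl.
- exact below_trans.
- intros x y; destruct (Nat.eq_dec x y) as [| E]; [auto |].
  destruct (classic (below par y x)) as [|h]; [auto |].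
  left; now apply below_not.
Qed.

Lemma below_zero a : 0 < a -> below par 0 a.
Proof.
induction a as [a IH] using (well_founded_induction lt_wf); intros Ha.
apply (below_later 0 a Ha); pose proof (par_lt a Ha).
destruct (par a) as [| b] eqn:E; [now left | right].
apply IH; lia.
Qed.

Lemma below_par n : 0 < n -> below par (par n) n.
Proof. intros H; apply below_later; [auto | now left]. Qed.

(** Together with [below_par], [n] comes immediately above its parent among the
    points up to [n]. *)
Lemma above_par n k : k < n -> below par (par n) k -> below par n k.
Proof.
intros Hk H; apply below_not; [lia |]; rewrite (below_later k n Hk).
intros [E | h]; [rewrite <- E in H; exact (below_irrefl _ H) |].
exact (below_irrefl _ (below_trans _ _ _ h H)).
Qed.

Definition fertile (x : nat) : Prop := forall m, exists n, m < n /\ par n = x.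

Definition sterile (x : nat) : Prop := exists m, forall n, m < n -> par n <> x.

Lemma fertile_above x m : fertile x ->
  exists n, m < n /\ below par x n /\ forall k, k <= m -> below par x k -> below par n k.
Proof.
intros H; destruct (H m) as (n & Hn & <-); exists n.
split; [exact Hn |]; split; [apply below_par; lia |].
intros k Hk; apply above_par; lia.
Qed.

Lemma fertile_between x y : fertile x -> below par x y ->
  exists z, below par x z /\ below par z y.
Proof. intros H Hxy; destruct (fertile_above x y H) as (n & _ & H1 & H2); eauto. Qed.

(** Once [x] has had its last child, a new point above [x] descends from an
    older point strictly above [x], so it cannot come first above [x]. *)
Lemma sterile_above x : sterile x ->
  exists m, forall n, below par x n ->
    exists k, k <= m /\ below par x k /\ (k = n \/ below par k n).
Proof.
intros [m Hm]; exists (m + x); intros n.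
induction n as [n IH] using (well_founded_induction lt_wf); intros Hxn.
destruct (le_lt_dec n (m + x)) as [h | h]; [exists n; auto |].
pose proof (par_lt n ltac:(lia)) as Hp.
destruct (proj1 (below_later x n ltac:(lia)) Hxn) as [E | E].
- destruct (Hm n ltac:(lia)); auto.
- destruct (IH (par n) Hp E) as (k & Hk & Hxk & Hkn); exists k; split; [exact Hk |].
  split; [exact Hxk |]; right.
  pose proof (below_par n ltac:(lia)) as Hn.
  destruct Hkn as [-> | Hkn]; [exact Hn | exact (below_trans _ _ _ Hkn Hn)].
Qed.

Lemma finite_max_upto (P : nat -> Prop) m : (exists k, k <= m /\ P k) ->
  exists a, a <= m /\ P a /\ forall b, b <= m -> P b -> b = a \/ below par b a.
Proof.
intros (k & Hk & HP).
destruct (finite_max (below par) (fun k => k) P (seq 0 (S m)) below_linear)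
  as (a & Ha & Pa & M).
- exists k; split; [apply in_seq; lia | exact HP].
- exists a; split; [apply in_seq in Ha; lia |]; split; [exact Pa |].
  intros b Hb; apply M, in_seq; lia.
Qed.

Lemma finite_min_upto (P : nat -> Prop) m : (exists k, k <= m /\ P k) ->
  exists a, a <= m /\ P a /\ forall b, b <= m -> P b -> b = a \/ below par a b.
Proof.
intros (k & Hk & HP).
destruct (finite_max _ (fun k => k) P (seq 0 (S m)) (linear_order_flip _ below_linear))
  as (a & Ha & Pa & M).
- exists k; split; [apply in_seq; lia | exact HP].
- exists a; split; [apply in_seq in Ha; lia |]; split; [exact Pa |].
  intros b Hb; apply M, in_seq; lia.
Qed.

Definition covers (x y : nat) : Prop :=
  below par x y /\ forall z, below par x z -> y = z \/ below par y z.

Lemma sterile_covers x y : sterile x -> below par x y -> exists s, covers x s.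
Proof.
intros H Hxy; destruct (sterile_above x H) as [m Hm].
destruct (finite_min_upto (fun k => below par x k) m) as (s & Hs & Hxs & M).
{ destruct (Hm y Hxy) as (k & Hk & H' & _); eauto. }
exists s; split; [exact Hxs |].
intros z Hz; destruct (Hm z Hz) as (k & Hk & Hxk & Hkz).
destruct (M k Hk Hxk) as [-> | Hsk]; [exact Hkz |].
destruct Hkz as [<- | Hkz]; [now right | right; exact (below_trans _ _ _ Hsk Hkz)].
Qed.

(** The point [0] serves as a virtual least element: it is removed. *)
Definition insertion_order (x y : nat) : Prop := below par (S x) (S y).

Lemma insertion_linear : linear_order insertion_order.
Proof.
destruct below_linear as [[I T] L]; split; [split |].
- intros x; apply I.
- intros x y z; apply T.
- intros x y; destruct (L (S x) (S y)) as [? | [E | ?]]; auto.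
Qed.

(** As [0] is fertile, some [x] is below all the parameters and some [x'] is
    below [x]; the immediate successor of [x'] is then below the parameters
    too, and nothing fits in between. *)
Lemma sterile_not_dense n :
  fertile 0 -> (forall x, 0 < x -> sterile x) -> ~ dense_off n insertion_order.
Proof.
intros F H D.
destruct (fertile_above 0 n F) as ([| x] & Hx & _ & Hxn); [lia |].
destruct (fertile_above 0 (S x) F) as ([| x'] & Hx' & _ & Hxx); [lia |].
specialize (Hxx (S x) (le_n _) (below_zero (S x) ltac:(lia))).
destruct (sterile_covers (S x') (S x) (H (S x') ltac:(lia)) Hxx) as ([| s] & Hs & M).
{ destruct (below_irrefl 0); exact (below_trans _ _ _ (below_zero (S x') ltac:(lia)) Hs). }
destruct (D x' s Hs) as (_ & z & _ & _ & Hz & Hz' & _).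
- intros c Hc; right; unfold insertion_order.
  assert (Hxc : below par (S x) (S c)) by (apply Hxn; [lia | apply below_zero; lia]).
  destruct (M (S x) Hxx) as [-> | h]; [exact Hxc | exact (below_trans _ _ _ h Hxc)].
- unfold insertion_order in Hz'.
  destruct (M (S z) Hz) as [E | h]; [rewrite E in Hz'; exact (below_irrefl _ Hz') |].
  exact (below_irrefl _ (below_trans _ _ _ h Hz')).
Qed.

(** The points [c <= w] may be sterile.  Points between [x] and [y] and above
    [y] come from the fertility of [x] and [y].  For a point below [x], let [c]
    be the greatest parameter below [x], or [0].  If [c] is fertile, there is
    something between [c] and [x]; if not, there is as well, because an immediate
    successor of [c] would be a parameter, which [x] is not. *)
Lemma fertile_dense w n :
  fertile 0 -> (forall x, w < x -> fertile x) -> w <= n ->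
  (forall c s, 0 < c <= w -> covers c s -> s <= n) -> dense_off n insertion_order.
Proof.
intros F0 F Hwn Hcov x y Hxy Hfree.
assert (free : forall c, 0 < c <= n -> below par c (S x) \/ below par (S y) c).
{ intros [| c] Hc; [lia |]; apply Hfree; lia. }
assert (Hx : n < S x).
{ destruct (le_lt_dec (S x) n) as [h |]; [| assumption].
  destruct (free (S x)) as [h' | h']; [lia | destruct (below_irrefl _ h') |].
  destruct (below_irrefl _ (below_trans _ _ _ h' Hxy)). }
assert (Hy : n < S y).
{ destruct (le_lt_dec (S y) n) as [h |]; [| assumption].
  destruct (free (S y)) as [h' | h']; [lia | | destruct (below_irrefl _ h')].
  destruct (below_irrefl _ (below_trans _ _ _ h' Hxy)). }
destruct (finite_max_upto (fun c => below par c (S x)) n) as (c & Hc & Hcx & Mc).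
{ exists 0; split; [lia | apply below_zero; lia]. }
assert (Z1 : exists z, below par c z /\ below par z (S x)).
{ destruct (classic (0 < c <= w)) as [h | h].
  - apply NNPP; intros Hno.
    assert (Hs : covers c (S x)); [| specialize (Hcov c (S x) h Hs); lia].
    split; [exact Hcx |]; intros z Hz.
    destruct (Nat.eq_dec (S x) z) as [| E]; [now left | right].
    apply below_not; [exact E | intros h'; apply Hno; eauto].
  - apply fertile_between; [| exact Hcx].
    destruct (Nat.eq_dec c 0) as [-> |]; [exact F0 | apply F; lia]. }
destruct Z1 as ([| z1] & Hcz & Hz1).
{ destruct c as [| c]; [destruct (below_irrefl _ Hcz) |].
  destruct (below_irrefl 0); exact (below_trans _ _ _ (below_zero (S c) ltac:(lia)) Hcz). }
destruct (fertile_between (S x) (S y) (F (S x) ltac:(lia)) Hxy) as ([| z2] & Hz2 & Hz2').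
{ destruct (below_irrefl 0); exact (below_trans _ _ _ (below_zero (S x) ltac:(lia)) Hz2). }
destruct (fertile_above (S y) n (F (S y) ltac:(lia))) as ([| z3] & _ & Hz3 & M3).
{ destruct (below_irrefl 0); exact (below_trans _ _ _ (below_zero (S y) ltac:(lia)) Hz3). }
exists z1, z2, z3; repeat split; try assumption.
all: try now apply Hz1. all: try now apply Hz2. all: try now apply Hz2'. all: try now apply Hz3.
intros d Hd; unfold insertion_order.
destruct (free (S d)) as [h | h]; [lia | left | right].
- destruct (Mc (S d)) as [-> | h']; [lia | exact h | exact Hcz |].
  exact (below_trans _ _ _ h' Hcz).
- apply M3; [lia | exact h].
Qed.

(** Each point has at most one immediate successor, so finitely many points have a
    common bound for theirs. *)
Lemma cover_bound w : exists n, w <= n /\ forall c s, 0 < c <= w -> covers c s -> s <= n.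
Proof.
induction w as [| w (n & Hn & IH)]; [exists 0; split; [lia | intros; lia] |].
destruct (classic (exists s, covers (S w) s)) as [[s Hs] | h].
- exists (S (n + s)); split; [lia |]; intros c t Hc Ht.
  destruct (Nat.eq_dec c (S w)) as [-> |]; [| specialize (IH c t ltac:(lia) Ht); lia].
  destruct Hs as [Hs Ms], Ht as [Ht Mt].
  destruct (Ms t Ht) as [-> | h]; [lia |].
  destruct (Mt s Hs) as [-> | h']; [lia |].
  destruct (below_irrefl _ (below_trans _ _ _ h h')).
- exists (S n); split; [lia |]; intros c t Hc Ht.
  destruct (Nat.eq_dec c (S w)) as [-> |]; [destruct h; eauto |].
  specialize (IH c t ltac:(lia) Ht); lia.
Qed.

End Insertion.

(** * Computability of insertion orders *)

Lemma computable_run (par : nat -> nat -> nat) k a b :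
  computable (fun u => par (p1 u) (p2 u)) -> computable k -> computable a -> computable b ->
  computable (fun v => run (par v) (k v) 1 (a v) (b v)).
Proof.
intros Hpar Hk Ha Hb.
assert (Hpar' : forall f g, computable f -> computable g -> computable (fun v => par (f v) (g v))).
{ intros f g Hf Hg.
  apply (computable_ext (fun v => par (p1 ⟨f v, g v⟩) (p2 ⟨f v, g v⟩))); [intros v; now unpair |].
  apply (computable_comp (fun u => par (p1 u) (p2 u)) (fun v => ⟨f v, g v⟩) Hpar); computability. }
set (step := fun v st =>
  if excluded_middle_informative (p1 (p2 st) = p2 (p2 st)) then st
  else if excluded_middle_informative (p1 (p2 st) < p2 (p2 st))
    then ⟨p1 st, ⟨p1 (p2 st), par v (p2 (p2 st))⟩⟩
    else ⟨1 - p1 st, ⟨p2 (p2 st), par v (p1 (p2 st))⟩⟩).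
apply (computable_ext (fun v =>
  p1 (nat_rec (fun _ => nat) ⟨1, ⟨a v, b v⟩⟩ (fun _ => step v) (k v)))).
- intros v; generalize (k v) as j, 1 as s, (a v) as x, (b v) as y; intros j.
  induction j as [| j IH]; intros s x y; [exact (p1_pair _ _) |].
  assert (H : forall st, nat_rec (fun _ => nat) st (fun _ => step v) (S j) =
    nat_rec (fun _ => nat) (step v st) (fun _ => step v) j).
  { intros st; clear; induction j as [| j IH]; [reflexivity |].
    cbn [nat_rec nat_rect] in *; now rewrite IH. }
  rewrite H; cbn [run]; unfold step at 1; unpair.
  destruct (excluded_middle_informative (x = y)) as [-> | E].
  + now rewrite Nat.eqb_refl, IH, run_refl.
  + rewrite (proj2 (Nat.eqb_neq x y) E).
    destruct (excluded_middle_informative (x < y)) as [h | h].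
    * now rewrite IH, (proj2 (Nat.ltb_lt x y) h).
    * rewrite IH; destruct (Nat.ltb_spec x y); [contradiction | reflexivity].
- apply (computable_p1 (fun v => nat_rec (fun _ => nat) ⟨1, ⟨a v, b v⟩⟩ (fun _ => step v) (k v))).
  apply (computable_rec (fun v => ⟨1, ⟨a v, b v⟩⟩) (fun v _ => step v)); [computability | | exact Hk].
  unfold step; apply (computable_if (fun u => p1 (p2 (p2 (p2 u))) = p2 (p2 (p2 (p2 u)))));
    [decidability | computability |].
  apply (computable_if (fun u => p1 (p2 (p2 (p2 u))) < p2 (p2 (p2 (p2 u)))));
    [decidability | |].
  + apply (computable_pair (fun u => p1 (p2 (p2 u)))); [computability |].
    apply (computable_pair (fun u => p1 (p2 (p2 (p2 u))))); [computability |].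
    apply Hpar'; computability.
  + apply (computable_pair (fun u => 1 - p1 (p2 (p2 u)))); [computability |].
    apply (computable_pair (fun u => p2 (p2 (p2 (p2 u))))); [computability |].
    apply Hpar'; computability.
Qed.

(** The point [S ⟨x, v⟩] is the [v]-th opportunity for [x] to get a child, taken
    when [Q x v] holds and left to [0] otherwise; [S] makes room for the
    virtual point [0]. *)
Definition parent (Q : nat -> nat -> Prop) (n : nat) : nat :=
  if excluded_middle_informative (0 < n /\ Q (p1 (n - 1)) (p2 (n - 1))) then p1 (n - 1) else 0.

Lemma p1_le n : p1 n <= n.
Proof. rewrite <- (pair_surj n) at 2; apply pair_ge. Qed.

Lemma parent_lt Q n : 0 < n -> parent Q n < n.
Proof.
intros H; unfold parent; pose proof (p1_le (n - 1)).
destruct (excluded_middle_informative _); lia.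
Qed.

Lemma parent_S Q x v : (Q x v -> parent Q (S ⟨x, v⟩) = x) /\ (~ Q x v -> parent Q (S ⟨x, v⟩) = 0).
Proof.
unfold parent; rewrite Nat.sub_succ, Nat.sub_0_r; unpair.
destruct (excluded_middle_informative _) as [[_ h] | h]; split; intros h'; try tauto.
destruct h; split; [lia | exact h'].
Qed.

Lemma parent_fertile_zero Q : fertile (parent Q) 0.
Proof.
intros m; exists (S ⟨0, m⟩); pose proof (pair_ge 0 m); split; [lia |].
destruct (parent_S Q 0 m), (classic (Q 0 m)); auto.
Qed.

Lemma parent_fertile (Q : nat -> nat -> Prop) x :
  (forall m, exists v, m < v /\ Q x v) -> fertile (parent Q) x.
Proof.
intros H m; destruct (H m) as (v & Hv & HQ); exists (S ⟨x, v⟩).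
pose proof (pair_ge x v); split; [lia | now apply parent_S].
Qed.

Lemma pair_mono t b m : b <= m -> ⟨t, b⟩ <= ⟨t, m⟩.
Proof.
intros H; pose proof (Cantor.to_nat_spec t b); pose proof (Cantor.to_nat_spec t m); nia.
Qed.

Lemma parent_sterile (Q : nat -> nat -> Prop) x :
  0 < x -> (exists m, forall v, Q x v -> v <= m) -> sterile (parent Q) x.
Proof.
intros Hx [m H]; exists (S ⟨x, m⟩); intros n Hn E.
unfold parent in E; destruct (excluded_middle_informative _) as [[_ HQ] | _]; [| lia].
rewrite E in HQ; pose proof (pair_mono x _ _ (H _ HQ)) as h.
rewrite <- E, pair_surj in h; rewrite E in h; lia.
Qed.

Lemma dec_insertion (Q : nat -> nat -> nat -> Prop) :
  dec (fun u => Q (p1 u) (p1 (p2 u)) (p2 (p2 u))) ->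
  dec (fun u => insertion_order (parent (Q (p1 u))) (p1 (p2 u)) (p2 (p2 u))).
Proof.
intros HQ; unfold insertion_order, below.
assert (H : computable (fun v => run (parent (Q (p1 v)))
  (S (p1 (p2 v)) + S (p2 (p2 v))) 1 (S (p1 (p2 v))) (S (p2 (p2 v))))).
{ apply (computable_run (fun v => parent (Q (p1 v)))); try computability.
  unfold parent.
  apply (computable_if (fun u => 0 < p2 u /\
    Q (p1 (p1 u)) (p1 (p2 u - 1)) (p2 (p2 u - 1)))); [| computability | computability].
  apply dec_and; [decidability |].
  apply (dec_ext (fun u => (fun t => Q (p1 t) (p1 (p2 t)) (p2 (p2 t))) ⟨p1 (p1 u), p2 u - 1⟩)).
  - intros u; now unpair.
  - apply (dec_subst _ (fun u => ⟨p1 (p1 u), p2 u - 1⟩) HQ); computability. }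
apply dec_and; [apply dec_eq; computability | decidability].
Qed.

Lemma eval_id x y : eval (Pair Fst Snd) x y <-> y = x.
Proof.
cbn; split.
- intros (a & b & -> & -> & ->); apply pair_surj.
- intros ->; exists (p1 x), (p2 x); repeat split; symmetry; apply pair_surj.
Qed.

Lemma computable_encode_const : computable (fun i => encode (const_code i)).
Proof.
apply (computable_ext (fun i => nat_rec (fun _ => nat) 0 (fun _ y => 5 + 4 * ⟨1, y⟩) i)).
- intros i; induction i as [| i IH]; cbn [nat_rec nat_rect const_code encode]; congruence.
- apply (computable_rec (fun _ => 0) (fun _ _ y => 5 + 4 * ⟨1, y⟩)); computability.
Qed.

Lemma computable_fun_intro f : computable f -> computable_fun f.
Proof. intros [c Hc]; exists (encode c); intros x; exists c; auto. Qed.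

(** The program numbered [f i] is that of [F] composed with a pair of a constant
    program and the identity, whose number is primitive recursive in [i]. *)
Lemma smn F : computable F ->
  exists f, computable_fun f /\ forall i x y, phi (f i) x y <-> y = F ⟨i, x⟩.
Proof.
intros [c Hc].
exists (fun i => encode (Comp c (Pair (const_code i) (Pair Fst Snd)))); split.
- apply computable_fun_intro; cbn [encode].
  pose proof computable_encode_const as H.
  change (computable (fun i =>
    5 + 4 * ⟨encode c, 4 + 4 * ⟨encode (const_code i), 4 + 4 * ⟨2, 3⟩⟩⟩)).
  apply (computable_add (fun _ => 5)); [computability |].
  apply (computable_mul (fun _ => 4)); [computability |].
  apply (computable_pair (fun _ => encode c)); [computability |].
  apply (computable_add (fun _ => 4)); [computability |].
  apply (computable_mul (fun _ => 4)); [computability |].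
  apply (computable_pair _ (fun _ => 4 + 4 * ⟨2, 3⟩) H); computability.
- intros i x y; split.
  + intros (d & E & H); apply encode_inj in E; subst d.
    destruct H as (u & (a & b & Ha & Hb & ->) & Hy).
    apply eval_id in Hb; subst b.
    rewrite (eval_fun _ _ _ _ Ha (eval_const_code i x)) in Hy.
    exact (eval_fun _ _ _ _ Hy (Hc _)).
  + intros ->; eexists; split; [reflexivity |].
    exists ⟨i, x⟩; split; [| apply Hc].
    exists i, x; split; [apply eval_const_code |]; split; [now apply eval_id | reflexivity].
Qed.

Lemma linear_order_ext (R S : nat -> nat -> Prop) :
  (forall x y, R x y <-> S x y) -> linear_order R -> linear_order S.
Proof.
intros E [[I T] L]; split; [split |].
- intros x h; apply (I x); now apply E.
- intros x y z h h'; apply E; apply (T x y z); now apply E.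
- intros x y; rewrite <- !E; apply L.
Qed.

Lemma dense_off_ext n (R S : nat -> nat -> Prop) :
  (forall x y, R x y <-> S x y) -> dense_off n R -> dense_off n S.
Proof.
intros E D x y Hxy F.
destruct (D x y) as (z1 & z2 & z3 & h1 & h2 & h3 & h4 & h5).
- now apply E.
- intros c Hc; rewrite !E; auto.
- exists z1, z2, z3; rewrite <- !E; repeat split; auto.
  intros c Hc; rewrite <- !E; auto.
Qed.

(** The form in which both reductions use the construction: a decidable rule
    gives a linear order in any case, and only its density depends on [i]. *)
Lemma insertion_reduction (Q : nat -> nat -> nat -> Prop) :
  dec (fun u => Q (p1 u) (p1 (p2 u)) (p2 (p2 u))) ->
  exists f, computable_fun f /\ (forall i, LIN (f i)) /\
    forall i n, dense_off n (ord (f i)) <-> dense_off n (insertion_order (parent (Q i))).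
Proof.
intros HQ; apply dec_insertion in HQ.
destruct (smn _ HQ) as (f & Hf & E); exists f.
assert (Eord : forall i x y, insertion_order (parent (Q i)) x y <-> ord (f i) x y).
{ intros i x y; unfold ord; rewrite E.
  match goal with |- context [char ?A ?u] => destruct (char_spec A u) as [H1 H0] end.
  unpair; split; [intros h; now rewrite H1 |].
  intros h; apply NNPP; intros h'; rewrite H0 in h by exact h'; discriminate. }
split; [exact Hf |]; split.
- intros i; split.
  + intros n; rewrite !E.
    match goal with |- context [char ?A ?u] => destruct (char_spec A u), (classic (A u)) end;
      [right | left]; symmetry; auto.
  + apply (linear_order_ext _ _ (Eord i)), insertion_linear, parent_lt.
- intros i n; split; apply dense_off_ext; intros x y; rewrite (Eord i x y); tauto.
Qed.

(** * Pi2 sets and infinitely many witnesses *)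

(** Finitely many columns, each of them finite, have a finite union. *)
Lemma bounded_union (P : nat -> Prop) T :
  (forall t, t < T -> exists m, forall b, P ⟨t, b⟩ -> b <= m) ->
  exists m, forall v, p1 v < T -> P v -> v <= m.
Proof.
induction T as [| T IH]; intros H; [exists 0; lia |].
destruct IH as [m Hm]; [auto |].
destruct (H T) as [m' Hm']; [lia |].
exists (m + ⟨T, m'⟩); intros v Hv HP.
destruct (Nat.eq_dec (p1 v) T) as [E |]; [| specialize (Hm v ltac:(lia) HP); lia].
rewrite <- (pair_surj v), E in HP |- *.
pose proof (pair_mono T _ _ (Hm' _ HP)); lia.
Qed.

(** If [A x] says that every [y] has a [z], then [Q x ⟨t, b⟩] says that [b] is the
    least bound under which every [y < t] has its [z].  Taking the least bound
    leaves at most one witness for each [t], so that a failure at one [y] leaves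
    only finitely many witnesses altogether. *)
Lemma Pi2_infinitely_often A : Pi0 2 A ->
  exists Q : nat -> nat -> Prop, dec (fun u => Q (p1 u) (p2 u)) /\
    forall x, (A x -> forall m, exists v, m < v /\ Q x v) /\
              (~ A x -> exists m, forall v, Q x v -> v <= m).
Proof.
intros (B & (C & HC & HB) & HA); apply dec_computable_set in HC.
set (G := fun x t b => forall y, y < t -> exists z, z < b /\ C ⟨⟨x, y⟩, z⟩).
exists (fun x v => G x (p1 v) (p2 v) /\ forall b, b < p2 v -> ~ G x (p1 v) b); split.
- assert (HG : forall f g h, computable f -> computable g -> computable h ->
    dec (fun u => G (f u) (g u) (h u))).
  { intros f g h Hf Hg Hh; unfold G.
    apply (dec_all_lt g (fun u y => exists z, z < h u /\ C ⟨⟨f u, y⟩, z⟩)); [exact Hg |].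
    apply (dec_ex_lt (fun v => h (p1 v)) (fun v z => C ⟨⟨f (p1 v), p2 v⟩, z⟩)); [computability |].
    apply (dec_subst C (fun w => ⟨⟨f (p1 (p1 w)), p2 (p1 w)⟩, p2 w⟩) HC); computability. }
  apply dec_and; [apply HG; computability |].
  apply (dec_all_lt (fun u => p2 (p2 u)) (fun u b => ~ G (p1 u) (p1 (p2 u)) b)); [computability |].
  apply dec_not, HG; computability.
- intros x; split.
  + intros Hx m.
    assert (E : exists b, G x (S m) b).
    { generalize (S m) as t; intros t; induction t as [| t [b Hb]]; [exists 0; intros y; lia |].
      destruct (proj1 (HB _) (proj1 (HA x) Hx t)) as [z Hz].
      exists (S (b + z)); intros y Hy; destruct (Nat.eq_dec y t) as [-> |].
      - exists z; split; [lia | exact Hz].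
      - destruct (Hb y) as (z' & h & h'); [lia |]; exists z'; split; [lia | exact h']. }
    destruct E as [b Hb].
    assert (E : exists b, G x (S m) b /\ forall b', b' < b -> ~ G x (S m) b').
    { revert Hb; induction b as [b IH] using (well_founded_induction lt_wf); intros Hb.
      destruct (classic (exists b', b' < b /\ G x (S m) b')) as [(b' & h & h') | h].
      - exact (IH b' h h').
      - exists b; split; [exact Hb |]; intros b' h' h''; apply h; eauto. }
    destruct E as (b' & H1 & H2); exists ⟨S m, b'⟩; unpair.
    pose proof (pair_ge (S m) b'); split; [lia | auto].
  + intros Hx; rewrite HA in Hx; apply not_all_ex_not in Hx; destruct Hx as [y Hy].
    destruct (bounded_union
      (fun v => G x (p1 v) (p2 v) /\ forall b, b < p2 v -> ~ G x (p1 v) b) (S y)) as [m Hm].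
    * intros t _.
      destruct (classic (exists b, G x t b /\ forall b', b' < b -> ~ G x t b')) as [[b [h h']] | h].
      -- exists b; intros b' [H H']; unpair.
         destruct (le_lt_dec b' b) as [| l]; [assumption | destruct (H' b l h)].
      -- exists 0; intros b' H; unpair; destruct h; eauto.
    * exists m; intros v HQ; apply Hm; [| exact HQ].
      destruct (le_lt_dec (S y) (p1 v)) as [h |]; [| assumption].
      destruct HQ as [HG _]; destruct (HG y h) as (z & _ & Hz).
      destruct Hy; apply HB; eauto.
Qed.

(** * Completeness *)

Lemma UHL_hard A : Pi0 2 A ->
  exists f, computable_fun f /\ (forall i, LIN (f i)) /\ forall i, A i <-> UHL (f i).
Proof.
intros HA; destruct (Pi2_infinitely_often A HA) as (Q & HQ & Hi).
destruct (insertion_reduction (fun i _ v => Q i v)) as (f & Hf & L & D).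
{ apply (dec_ext (fun u => (fun t => Q (p1 t) (p2 t)) ⟨p1 u, p2 (p2 u)⟩)).
  - intros u; now unpair.
  - apply (dec_subst _ (fun u => ⟨p1 u, p2 (p2 u)⟩) HQ); computability. }
exists f; split; [exact Hf |]; split; [exact L |].
intros i; rewrite UHL_dense, D; destruct (Hi i) as [H1 H0]; split.
- intros h; split; [apply L |].
  apply (fertile_dense _ (parent_lt _) 0 0); try lia.
  + apply parent_fertile_zero.
  + intros x _; now apply parent_fertile, H1.
- intros [_ h]; apply NNPP; intros h'; revert h.
  apply sterile_not_dense; [apply parent_lt | apply parent_fertile_zero |].
  intros x Hx; apply parent_sterile; [exact Hx | auto].
Qed.

Lemma WUL_hard A : Sigma0 3 A ->
  exists f, computable_fun f /\ (forall i, LIN (f i)) /\ forall i, A i <-> WUL (f i).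
Proof.
intros (B & HB & HA); destruct (Pi2_infinitely_often B HB) as (Q & HQ & Hi).
destruct (insertion_reduction (fun i x v => p1 v <= x /\ Q ⟨i, p1 v⟩ (p2 v)))
  as (f & Hf & L & D).
{ apply dec_and; [decidability |].
  apply (dec_ext (fun u => (fun t => Q (p1 t) (p2 t)) ⟨⟨p1 u, p1 (p2 (p2 u))⟩, p2 (p2 (p2 u))⟩)).
  - intros u; now unpair.
  - apply (dec_subst _ (fun u => ⟨⟨p1 u, p1 (p2 (p2 u))⟩, p2 (p2 (p2 u))⟩) HQ); computability. }
exists f; split; [exact Hf |]; split; [exact L |].
intros i; rewrite WUL_dense, HA; split.
- intros [w Hw]; split; [apply L |].
  destruct (cover_bound _ (parent_lt (fun x v => p1 v <= x /\ Q ⟨i, p1 v⟩ (p2 v))) w)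
    as (n & Hn & Hc).
  exists n; apply D, (fertile_dense _ (parent_lt _) w); auto.
  + apply parent_fertile_zero.
  + intros x Hx; apply parent_fertile; intros m.
    destruct (proj1 (Hi _) Hw m) as (v & Hv & HQv).
    exists ⟨w, v⟩; pose proof (pair_ge w v); unpair; split; [lia |].
    split; [lia | exact HQv].
- intros (_ & n & h); apply NNPP; intros h'; revert h; rewrite D.
  apply sterile_not_dense; [apply parent_lt | apply parent_fertile_zero |].
  intros x Hx; apply parent_sterile; [exact Hx |].
  destruct (bounded_union (fun v => Q ⟨i, p1 v⟩ (p2 v)) (S x)) as [m Hm].
  + intros t _.
    destruct (proj2 (Hi ⟨i, t⟩)) as [m Hm]; [intros HBt; apply h'; eauto |].
    exists m; intros b; unpair; auto.
  + exists m; intros v [Hv HQv]; apply Hm; [lia | exact HQv].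
Qed.

(** As [B] is contained in [C], it serves itself as the set in [Gamma] that cuts
    it out of [C], and both notions of completeness reduce to hardness. *)
Lemma complete_from_relative Gamma (B C : nat -> Prop) :
  Gamma B -> (forall e, B e -> C e) ->
  (forall A, Gamma A ->
    exists f, computable_fun f /\ (forall i, C (f i)) /\ forall i, A i <-> B (f i)) ->
  complete Gamma B /\ complete_relative Gamma B C.
Proof.
intros HB HBC H; split; split; try exact HB; try exact H.
- intros A HA; destruct (H A HA) as (f & Hf & _ & E); eauto.
- exists B; split; [exact HB |]; intros i; split; [auto | tauto].
Qed.

Theorem theorem3p5 :
  (complete (Pi0 2) UHL /\ complete_relative (Pi0 2) UHL LIN) /\
  (complete (Sigma0 3) WUL /\ complete_relative (Sigma0 3) WUL LIN).
Proof.
split; apply complete_from_relative.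
- exact UHL_Pi2.
- intros e [L _]; exact L.
- exact UHL_hard.
- exact WUL_Sigma3.
- intros e [L _]; exact L.
- exact WUL_hard.
Qed.
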